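(* For every positive integer $r$ and all $p_0<1$, $\varepsilon>0$, and $K$, there exist a $\lambda>0$ and a constant $C$ such that the following holds. Let $V$ be a finite set and let $f$ be an $r$-homogeneous multilinear polynomial in variables $(y_v)_{v\in V}$ with nonnegative coefficients. Let $p\in(0,p_0]$ and let $Y=(Y_v)_{v\in V}$ be a sequence of i.i.d. $\mathrm{Ber}(p)$ random variables. Suppose that, for every nonempty $B\subseteq V$ with $|B|\le r$, $$\partial_Bf(\mathbf 1)\le K\cdot(\lambda p)^{|B|-1}\cdot\frac{f(\mathbf 1)}{|V|}.$$ Then, letting $X=f(Y)$, for every nonnegative real $\eta$, $$-\log\Pr\big(X\le\eta\,\mathbb E[X]\big)\ \ge\ (1-\varepsilon)\,\Phi_p^f(\eta+\varepsilon)-C.$$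
   Context: $\mathbf 1$ is the all-ones vector in $\mathbb R^V$. For $B=\{v_1,\dots,v_k\}\subseteq V$, $\partial_Bf=\frac{\partial}{\partial y_{v_1}}\cdots\frac{\partial}{\partial y_{v_k}}f$. For $q\in[0,1]^V$, $Y^{(q)}=(Y'_v)_{v\in V}$ is a sequence of independent Bernoulli variables with $\Pr(Y'_v=1)=q_v$. With natural logarithms and $0\log0=0$, let $$D_{KL}(Y^{(q)}\,\|\,Y)=\sum_{v\in V}\Big(q_v\log\frac{q_v}p+(1-q_v)\log\frac{1-q_v}{1-p}\Big)$$ be the Kullback–Leibler divergence, and $$\Phi_p^f(\eta)=\min\Big\{D_{KL}(Y^{(q)}\,\|\,Y):\ q\in[0,1]^V,\ \mathbb E[f(Y^{(q)})]\le\eta\cdot\mathbb E[f(Y)]\Big\}.$$ *)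

(* Defs.v *)
From HB Require Import structures.
From mathcomp Require Import all_boot all_order all_algebra.
From mathcomp Require mpoly.
(* The notations of mpoly clash with those of MathComp-Analysis. *)
Import -(notations) mpoly.
From mathcomp Require Import all_classical all_reals all_analysis.
Import numFieldNormedType.Exports.

Set Implicit Arguments.
Unset Strict Implicit.
Unset Printing Implicit Defensive.

Import Order.TTheory GRing.Theory Num.Theory.
Local Open Scope classical_set_scope.
Local Open Scope ring_scope.

(* Polynomials in variables (y_v)_{v in V}: the variable y_v is the one of index
   enum_rank v of a multivariate polynomial in #|V| variables. *)
Definition vpoly (R : realType) (V : finType) := mpoly #|V| R.

Section Polynomials.
Context {R : realType} {V : finType}.
Implicit Types (f : vpoly R V) (y : V -> R).

Definition vpoly_eval f y : R := meval (fun i => y (enum_val i)) f.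

Definition homogeneous (r : nat) f : Prop := f \is ishomog1 r mdeg.

Definition multilinear f : Prop :=
  forall m : multinom #|V|, m \in msupp f -> forall i, (m i <= 1)%N.

Definition nonneg_coeffs f : Prop := forall m : multinom #|V|, 0 <= mcoeff m f.

(* Formal partial derivatives commute, so the enumeration order is irrelevant. *)
Definition partial (B : {set V}) f : vpoly R V :=
  foldr (fun v g => mderiv (enum_rank v) g) f (enum B).

End Polynomials.

Section RandomVariables.
Context {R : realType} {V : finType}.
Context {d : measure_display} {T : measurableType d}.
Variable P : probability T R.

Definition mutually_independent (Y : V -> {RV P >-> bool}) : Prop :=
  forall (B : {set V}) (A : V -> set bool),
    P (\bigcap_(v in [set` B]) (Y v @^-1` A v)) =
    (\prod_(v in B) P (Y v @^-1` A v))%E.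

Definition iid_bernoulli (p : R) (Y : V -> {RV P >-> bool}) : Prop :=
  (forall v, distribution P (Y v) =1 bernoulli_prob p) /\
  mutually_independent Y.

End RandomVariables.

Section RateFunction.
Context {R : realType} {V : finType}.
Implicit Types (f : vpoly R V) (p eta : R) (q : V -> R).

(* E[f(Y^(q))], for Y^(q) distributed on {0,1}^V as the product of the Ber(q_v). *)
Definition mean_bernoulli q f : R :=
  \sum_(w : {ffun V -> bool})
    (\prod_v bernoulli_pmf (q v) (w v)) * vpoly_eval f (fun v => (w v)%:R).

(* ln 0 = 0 in the library, hence 0 log 0 = 0. *)
Definition KL_divergence p q : R :=
  \sum_v (q v * ln (q v / p) + (1 - q v) * ln ((1 - q v) / (1 - p))).

Definition feasible p f eta : set (V -> R) :=
  [set q | (forall v, 0 <= q v <= 1) /\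
           mean_bernoulli q f <= eta * mean_bernoulli (fun=> p) f].

(* For 0 < p < 1 and eta >= 0 this infimum is attained when f is homogeneous of
   positive degree with nonnegative coefficients: see Phi_min and
   feasible_nonempty. *)
Definition Phi p f eta : R := inf [set KL_divergence p q | q in feasible p f eta].

End RateFunction.

Lemma continuous_xlnx {R : realType} : continuous (fun x : R => x * ln x).
Proof.
move=> x; case: (ltgtP x 0) => [x0|x0|->].
- rewrite /continuous_at (ln0 (ltW x0)) mulr0.
  apply: cvg_near_cst; near=> y; rewrite ln0 ?mulr0//.
  by apply: ltW; near: y; exact: lt_nbhsl.
- by apply: cvgM; [exact: cvg_id | exact: continuous_ln].
rewrite /continuous_at mul0r.
apply/cvgr0Pnorm_le => e e0; near=> y.
have [y0|y0] := leP y 0; first by rewrite ln0// mulr0 normr0 ltW.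
have y1 : y <= 1 by apply: ltW; near: y; exact: lt_nbhsl.
have s0 : 0 < Num.sqrt y by rewrite sqrtr_gt0.
have hy : y = Num.sqrt y ^+ 2 by rewrite sqr_sqrtr// ltW.
have hs : Num.sqrt y <= e / 2.
  rewrite -(ger0_norm (ltW (_ : 0 < e / 2))) ?divr_gt0// -sqrtr_sqr.
  by rewrite ler_wsqrtr//; apply: ltW; near: y; apply: lt_nbhsl;
     rewrite exprn_gt0// divr_gt0.
rewrite ler0_norm; last by rewrite mulr_ge0_le0 ?ln_le0// ltW.
have hl : - ln (Num.sqrt y) <= (Num.sqrt y)^-1.
  by rewrite -lnV ?posrE// ltW// ln_sublinear// invr_gt0.
rewrite hy; move: (Num.sqrt y) s0 hs hl => s s0 hs hl.
rewrite lnXn// -mulrN -mulNrn mulrnAr -mulr_natr -ler_pdivlMr//.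
apply: le_trans hs; rewrite expr2 -mulrA -[leRHS]mulr1.
apply: ler_wpM2l; first exact: ltW.
by rewrite -(mulfV (lt0r_neq0 s0)); apply: ler_wpM2l => //; exact: ltW.
Unshelve. all: by end_near.
Qed.

Section RateMin.
Context {R : realType} {V : finType}.
Implicit Types (f : vpoly R V) (p eta : R) (q : V -> R).

Let continuous_coord (v : V) : continuous (fun q : {ptws V -> R} => q v).
Proof. by move=> q; exact: (@proj_continuous V (fun=> R) v). Qed.

Let cont_sum (I : finType) (F : I -> {ptws V -> R} -> R) :
  (forall i, continuous (F i)) ->
  continuous (fun q : {ptws V -> R} => \sum_i F i q).
Proof. by move=> h; apply: continuous_big => //; exact: add_continuous. Qed.

Let cont_prod (I : finType) (F : I -> {ptws V -> R} -> R) :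
  (forall i, continuous (F i)) ->
  continuous (fun q : {ptws V -> R} => \prod_i F i q).
Proof. by move=> h; apply: continuous_big => //; exact: mul_continuous. Qed.

Lemma continuous_KL p :
  0 < p -> p < 1 -> continuous (fun q : {ptws V -> R} => KL_divergence p q).
Proof.
move=> p0 p1.
have h (a : R) : 0 < a -> continuous (fun x : R => x * ln (x / a)).
  move=> a0; have -> : (fun x : R => x * ln (x / a)) =
      (fun x => a * (x / a * ln (x / a))).
    by apply/funext => x; rewrite mulrA mulrCA mulfV ?gt_eqF// mulr1.
  move=> x; apply: cvgM; first exact: cvg_cst.
  apply: (@continuous_comp _ _ _ (fun x : R => x / a) (fun y : R => y * ln y)).
    by apply: cvgM; [exact: cvg_id|exact: cvg_cst].
  exact: continuous_xlnx.
pose F (v : V) (q : {ptws V -> R}) :=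
  q v * ln (q v / p) + (1 - q v) * ln ((1 - q v) / (1 - p)).
suff cF v : continuous (F v) by exact: (cont_sum cF).
have c1 : continuous (fun q : {ptws V -> R} => q v * ln (q v / p)).
  move=> q; exact: (continuous_comp (@continuous_coord v q) (h p p0 (q v))).
have c2 : continuous (fun q : {ptws V -> R} => 1 - q v).
  by move=> q; exact: (cvgB (cvg_cst (1 : R)) (@continuous_coord v q)).
have c3 : continuous (fun q : {ptws V -> R} =>
    (1 - q v) * ln ((1 - q v) / (1 - p))).
  have p1' : 0 < 1 - p by rewrite subr_gt0.
  move=> q; exact: (continuous_comp (c2 q) (h _ p1' (1 - q v))).
by move=> q; exact: (cvgD (c1 q) (c3 q)).
Qed.

Lemma continuous_mean f :
  continuous (fun q : {ptws V -> R} => mean_bernoulli q f).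
Proof.
pose F (w : {ffun V -> bool}) (q : {ptws V -> R}) :=
  (\prod_v bernoulli_pmf (q v) (w v)) * vpoly_eval f (fun v => (w v)%:R).
suff cF w : continuous (F w) by exact: (cont_sum cF).
pose G (v : V) (q : {ptws V -> R}) := bernoulli_pmf (q v) (w v).
have cG v : continuous (G v).
  rewrite /G /bernoulli_pmf; case: (w v); first exact: continuous_coord.
  by move=> q; exact: (cvgB (cvg_cst (1 : R)) (@continuous_coord v q)).
move=> q.
have cP : continuous (fun q : {ptws V -> R} => \prod_v G v q) := cont_prod cG.
exact: (cvgM (cP q) (cvg_cst _)).
Qed.

Lemma compact_feasible p f eta :
  compact (feasible p f eta : set {ptws V -> R}).
Proof.
have cK : compact [set q : {ptws V -> R} | forall v, `[0, 1]%classic (q v)].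
  exact: (@tychonoff V (fun=> R) (fun=> `[0, 1]%classic)
    (fun=> @segment_compact R 0 1)).
apply: subclosed_compact cK _; last first.
  by move=> q [h _] v /=; rewrite in_itv/= h.
pose A := \bigcap_(v in [set: V])
  ((fun q : {ptws V -> R} => q v) @^-1` `[(0 : R), 1]%classic).
pose B := (fun q : {ptws V -> R} => mean_bernoulli q f) @^-1`
  [set x | x <= eta * mean_bernoulli (fun=> p) f].
have -> : (feasible p f eta : set {ptws V -> R}) = A `&` B.
  apply/seteqP; split => q /= [h1 h2]; split => //.
    by move=> v _; rewrite /= in_itv/= h1.
  by move=> v; have := h1 v I; rewrite /= in_itv.
apply: closedI.
  apply: closed_bigI => v _.
  have /continuous_closedP := @continuous_coord v; apply.
  exact: itv_closed.
have /continuous_closedP := @continuous_mean f; apply.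
exact: closed_le.
Qed.

Lemma Phi_min p f eta : 0 < p -> p < 1 -> feasible p f eta !=set0 ->
  exists q, [/\ feasible p f eta q,
    forall q', feasible p f eta q' -> KL_divergence p q <= KL_divergence p q'
    & Phi p f eta = KL_divergence p q].
Proof.
move=> p0 p1 ne.
have [q qF qm] := @compact_EVT_min _ _ (fun q : {ptws V -> R} => KL_divergence p q)
  (feasible p f eta) ne (@compact_feasible p f eta)
  (continuous_subspaceT (continuous_KL p0 p1)).
move: qF; rewrite inE => qF; exists q.
have {}qm q' : feasible p f eta q' -> KL_divergence p q <= KL_divergence p q'.
  by move=> h; apply: qm; rewrite inE.
split=> //; apply/eqP; rewrite eq_le; apply/andP; split.
  apply: ge_inf; last by exists q.
  by exists (KL_divergence p q) => _ [q' h <-]; exact: qm.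
apply: lb_le_inf; first by exists (KL_divergence p q), q.
by move=> _ [q' h <-]; exact: qm.
Qed.

Lemma feasible_nonempty (r : nat) p f eta : (0 < r)%N -> homogeneous r f ->
  nonneg_coeffs f -> 0 < p -> p < 1 -> 0 <= eta -> feasible p f eta !=set0.
Proof.
move=> r0 hf nf p0 p1 eta0.
have ev y : (forall v, 0 <= y v) -> 0 <= vpoly_eval f y.
  move=> y0; rewrite /vpoly_eval mevalE; apply: sumr_ge0 => m _.
  by apply: mulr_ge0 => //; apply: prodr_ge0 => i _; exact: exprn_ge0.
have ev0 : vpoly_eval f (fun=> 0) = 0.
  rewrite /vpoly_eval mevalE big_seq big1// => m mf.
  have dm : mdeg m = r := dhomog_mf hf mf.
  have [i mi] : exists i, m i != 0%N.
    apply/existsP; apply: contraTT r0 => /existsPn h; rewrite -leqNgt -dm mdegE.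
    by rewrite big1// => i _; apply/eqP; move: (h i); rewrite negbK.
  by rewrite (bigD1 i)//= expr0n (negbTE mi) mul0r mulr0.
have mp : 0 <= mean_bernoulli (fun=> p) f.
  apply: sumr_ge0 => w _; apply: mulr_ge0; last by apply: ev => v; exact: ler0n.
  by apply: prodr_ge0 => v _; apply: bernoulli_pmf_ge0; rewrite !ltW.
exists (fun=> 0); split=> [v|]; first by rewrite lexx ler01.
rewrite (_ : mean_bernoulli _ _ = 0) ?mulr_ge0//.
apply: big1 => w _.
have [/forallP h|/forallPn[v]] := boolP [forall v, ~~ w v].
  have -> : (fun v => (w v)%:R) = (fun=> 0) :> (V -> R).
    by apply/funext => v; rewrite (negbTE (h v)).
  by rewrite ev0 mulr0.
by rewrite negbK => wv; rewrite (bigD1 v)//= wv /= !mul0r.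
Qed.

End RateMin.

(* Main.v *)
Require Import Defs.
From mathcomp Require Import all_boot all_order all_algebra.
From mathcomp Require mpoly.
From mathcomp Require Import all_classical all_reals all_analysis.
From mathcomp Require Import ring lra.

(** Let [m] be the law of the support [{v | Y_v = 1}] given the lower-tail
    event, a weight on [{set V}].  The event is decreasing, so adding a point
    [v] to a configuration multiplies [m] by at most [p / (1 - p)].  This
    domination survives conditioning on any set of coordinates: the conditional
    probability of [Y_v = 1] given [Y_W] is at most [p] when [v] is outside [W],
    and [Y_S = 1] has probability at most [p ^ |S|].  It takes the place of all
    upper-tail estimates.

    Reveal the coordinates in a set [W], and let [q_v] be the conditional
    probability of [Y_v = 1] for [v] outside [W] and [q_v = p] inside.  By the
    chain rule the expected divergence of [q] is at most minus the logarithm of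
    the lower-tail probability ([entropy_budget]).  It thus suffices that [q] is
    feasible for [Phi (eta + eps)] with probability at least [1 - eps].  Given
    [Y_W] the mean of [X] is still at most [eta * E X], so the mean of [f] under
    [q] can exceed this only through the monomials that meet [W], and through
    the decoupling error: the sum over the other monomials [S] of the
    difference between the conditional probability of [Y_S = 1] and the product
    of the [q_v].  Markov's inequality applies once the two together are at most
    [eps ^ 2 * E X] in mean.

    The set [W] comes from a random labelling of [V] by [M] labels
    ([exists_pinning]).  Let [W_i] be the set of points with label below [i].
    The probability of [Y_v = 1] given [Y] on [W_i] without [v] is a martingale
    in [i] that stays between [0] and [p]; hence among [a ^ 2] successive layers
    one carries total squared increments at most [|V| * p ^ 2 / a ^ 2]
    ([quiet_layer]).  Telescoping the product [q_S] reduces the decoupling error to correlations between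
    [Y_v] and [Y_B = 1].  If [B] lies in layer [i], this correlation given
    [Y_{W_i}] is at most the mean of [1_{Y_B = 1}] times the increment of the
    marginal of [v] across the layer ([defect_le]).  Summation over [B] and
    Cauchy-Schwarz leave the second moment of a weighted degree of [v] inside
    the layer ([layer_degree_moment]).  Within a layer each point is present
    with density [p / M], and the hypothesis on the derivatives with
    [lambda = 1 / M] says exactly that the codegrees of [f] decay at this rate,
    which bounds that second moment by its order when the points are spread
    out.  The decoupling error is then of order [1 / a], and the monomials
    meeting [W] have relative weight at most [r * a ^ 2 / M]; first [a], then
    [M] is taken large, and [C = 0] suffices. *)

Set Implicit Arguments.
Unset Strict Implicit.
Unset Printing Implicit Defensive.
Import Order.TTheory GRing.Theory Num.Theory.
Local Open Scope ring_scope.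

(** * Conditioning on coordinates *)

Section ConditionalExpectation.
Import boot.finset.
Variables (R : realType) (V : finType) (m : {set V} -> R).
Hypothesis m_ge0 : forall x, 0 <= m x.
Implicit Types (W B S x y : {set V}) (g u : {set V} -> R).

Definition contains B x : R := (B \subset x)%:R.

Definition cond W g x : R :=
  (\sum_(y | y :&: W == x :&: W) m y * g y) / \sum_(y | y :&: W == x :&: W) m y.

(** Functions of the coordinates in [W], that is, measurable for the partition
    of configurations by their trace on [W]. *)
Definition determined_by W g := forall x y, x :&: W = y :&: W -> g x = g y.

Lemma cond_determined W g : determined_by W (cond W g).
Proof. by move=> x y exy; rewrite /cond exy. Qed.

Lemma determined_by_subset W W' g :
  W \subset W' -> determined_by W g -> determined_by W' g.
Proof.
move=> sW gW x y exy; apply: gW.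
by rewrite -(setIidPr sW) !setIA exy.
Qed.

Lemma contains_determined W B : B \subset W -> determined_by W (contains B).
Proof.
move=> BW x y exy; rewrite /contains.
have h (z : {set V}) : (B \subset z) = (B \subset z :&: W) by rewrite subsetI BW andbT.
by rewrite h exy -h.
Qed.

Lemma contains_ge0 B x : 0 <= contains B x.
Proof. exact: ler0n. Qed.

Lemma containsU B B' x : contains B x * contains B' x = contains (B :|: B') x.
Proof. by rewrite /contains subUset -natrM mulnb. Qed.

Lemma weight_class_eq0 W x :
  \sum_(y | y :&: W == x :&: W) m y = 0 -> m x = 0.
Proof.
move=> h; have := psumr_eq0P (fun y _ => m_ge0 y) h; apply; exact: eqxx.
Qed.

(** Classes of weight zero are harmless: the weight is nonnegative, so it
    vanishes at every point of such a class, whatever value the division by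
    zero gives to [cond]. *)
Lemma tower W u g : determined_by W u ->
  \sum_x m x * (u x * cond W g x) = \sum_x m x * (u x * g x).
Proof.
move=> uW; rewrite /cond.
pose D x := \sum_(y | y :&: W == x :&: W) m y.
transitivity (\sum_x \sum_(y | y :&: W == x :&: W)
    m x * (u y * (m y * g y) / D y)).
  apply: eq_bigr => x _; rewrite mulrA mulr_suml mulr_sumr.
  apply: eq_bigr => y /eqP exy.
  by rewrite /D exy (uW _ _ exy); ring.
under eq_bigr do rewrite big_mkcond.
rewrite exchange_big/=; apply: eq_bigr => y _.
rewrite -big_mkcond/= -mulr_suml.
rewrite (eq_bigl (fun x => x :&: W == y :&: W)); last by move=> x; rewrite eq_sym.
rewrite -/(D y); have [Dy|Dy] := eqVneq (D y) 0.
  by rewrite Dy (weight_class_eq0 Dy) !mul0r.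
by rewrite mulrC divfK// mulrCA.
Qed.

Lemma cond_ge0 W g x : (forall y, 0 <= g y) -> 0 <= cond W g x.
Proof.
move=> g0; apply: divr_ge0; apply: sumr_ge0 => y _ //.
exact: mulr_ge0.
Qed.

Lemma cond_const W x : m x != 0 -> cond W (contains set0) x = 1.
Proof.
move=> mx; rewrite /cond /contains.
under eq_bigr do rewrite sub0set mulr1.
by rewrite mulfV//; apply: contra_neq mx => /weight_class_eq0.
Qed.

Lemma cond_sum (I : finType) (Q : pred I) W (c : I -> R) (g : I -> {set V} -> R) x :
  cond W (fun y => \sum_(i | Q i) c i * g i y) x = \sum_(i | Q i) c i * cond W (g i) x.
Proof.
rewrite /cond; under eq_bigr do rewrite mulr_sumr.
rewrite exchange_big/= mulr_suml; apply: eq_bigr => i _.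
rewrite mulrA mulr_sumr; congr (_ / _); apply: eq_bigr => y _.
by rewrite mulrCA.
Qed.

Lemma cond_le W g x a : m x != 0 -> (forall y, m y != 0 -> g y <= a) -> cond W g x <= a.
Proof.
move=> mx ga; rewrite /cond.
have Dx : 0 < \sum_(y | y :&: W == x :&: W) m y.
  rewrite lt_neqAle sumr_ge0 // andbT eq_sym.
  by apply: contra_neq mx => /weight_class_eq0.
rewrite ler_pdivrMr// mulr_sumr; apply: ler_sum => y _.
have [->|my] := eqVneq (m y) 0; first by rewrite mul0r mulr0.
by rewrite mulrC ler_wpM2r// ga.
Qed.

Definition marginal v W := cond W (contains [set v]).

Lemma marginal_ge0 v W x : 0 <= marginal v W x.
Proof. apply: cond_ge0 => y; exact: contains_ge0. Qed.

(** Orthogonality of martingale increments: the cross term is the second moment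
    of the earlier marginal. *)
Lemma marginal_variance v W W' : W \subset W' ->
  \sum_x m x * (marginal v W' x - marginal v W x) ^+ 2 =
  \sum_x m x * marginal v W' x ^+ 2 - \sum_x m x * marginal v W x ^+ 2.
Proof.
move=> sW.
have h1 := tower (contains [set v]) (@cond_determined W (contains [set v])).
have h2 := tower (contains [set v])
  (determined_by_subset sW (@cond_determined W (contains [set v]))).
rewrite -/(marginal v W) -/(marginal v W') in h1 h2.
have -> : \sum_x m x * (marginal v W' x - marginal v W x) ^+ 2 =
    \sum_x m x * marginal v W' x ^+ 2
    - 2 * (\sum_x m x * (marginal v W x * marginal v W' x))
    + \sum_x m x * (marginal v W x * marginal v W x).
  rewrite mulr_sumr -sumrB -big_split/=; apply: eq_bigr => x _; ring.
rewrite h2 -h1.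
have -> : \sum_x m x * marginal v W x ^+ 2 = \sum_x m x * (marginal v W x * marginal v W x).
  by apply: eq_bigr => x _; rewrite expr2.
ring.
Qed.

(** The mean absolute conditional covariance, given the coordinates in [W], of
    the events that [B] and that [v] are contained in the configuration. *)
Definition defect W B v :=
  \sum_x m x * `|cond W (contains (v |: B)) x - cond W (contains B) x * marginal v W x|.

Lemma defect_ge0 W B v : 0 <= defect W B v.
Proof. by apply: sumr_ge0 => x _; exact: mulr_ge0. Qed.

(** The conditional covariance is the conditional mean of
    [1_B * (1_v - marginal v W)], and its sign depends on the coordinates in [W]
    only.  Once [B] is revealed along with [W'], the indicator of [v] may be
    replaced by its conditional mean given [W']. *)
Lemma defect_le W W' B v : W \subset W' -> B \subset W' ->
  defect W B v <= \sum_x m x * (contains B x * `|marginal v W' x - marginal v W x|).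
Proof.
move=> sW BW.
pose s x := Num.sg (cond W (contains (v |: B)) x - cond W (contains B) x * marginal v W x).
have sWd : determined_by W s by move=> x y e; rewrite /s /marginal !(cond_determined _ e).
have qd : determined_by W (marginal v W) by exact: cond_determined.
have suW : determined_by W (fun x => s x * marginal v W x).
  by move=> x y e; rewrite (sWd _ _ e) (qd _ _ e).
have sbW : determined_by W' (fun x => s x * contains B x).
  move=> x y e; rewrite (contains_determined BW e).
  by rewrite (determined_by_subset sW sWd e).
have -> : defect W B v =
    \sum_x m x * (s x * contains B x * (marginal v W' x - marginal v W x)).
  transitivity (\sum_x m x * (s x * cond W (contains (v |: B)) x)
      - \sum_x m x * (s x * marginal v W x * cond W (contains B) x)).
    rewrite -sumrB; apply: eq_bigr => x _.
    have e (a b c k t : R) : k * (a * (b - c * t)) = k * (a * b) - k * (a * t * c).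
      by ring.
    by rewrite normrEsg; exact: e.
  rewrite (tower _ sWd) (tower _ suW).
  have hb := tower (contains [set v]) sbW; rewrite -/(marginal v W') in hb.
  transitivity (\sum_x m x * (s x * contains B x * contains [set v] x)
      - \sum_x m x * (s x * marginal v W x * contains B x)).
    by congr (_ - _); apply: eq_bigr => x _; rewrite -containsU [contains [set v] x * _]mulrC !mulrA.
  rewrite -hb -sumrB; apply: eq_bigr => x _.
  have e (a b c k t : R) : k * (a * b * c) - k * (a * t * b) = k * (a * b * (c - t)).
    by ring.
  exact: e.
apply: ler_sum => x _; apply: ler_wpM2l => //.
apply: le_trans (ler_norm _) _; rewrite !normrM.
rewrite (ger0_norm (contains_ge0 _ _)); apply: ler_wpM2r => //.
rewrite -[leRHS]mul1r; apply: ler_wpM2r; first exact: contains_ge0.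
by rewrite /s normr_sg; case: (_ == _).
Qed.

Section Domination.
Variable p : R.
Hypotheses (p_ge0 : 0 <= p) (m_dom : forall v x, v \notin x -> (1 - p) * m (v |: x) <= p * m x).

(** Pairing each [x] that avoids [v] with [v |: x] compares the two halves of
    [U] term by term; [U] may be any event that does not depend on [v], which
    makes the domination usable after conditioning. *)
Lemma dominated_insert (U : pred {set V}) v : (forall x, U (v |: x) = U x) ->
  \sum_(x | U x && (v \in x)) m x <= p * \sum_(x | U x) m x.
Proof.
move=> Uv; rewrite [in leRHS](bigID (fun x : {set V} => v \in x))/=.
have E : \sum_(x | U x && (v \in x)) m x = \sum_(x | U x && (v \notin x)) m (v |: x).
  rewrite (reindex_onto (fun x => v |: x) (fun x => x :\ v))/=; last first.
    by move=> x /andP[_ vx]; rewrite setD1K.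
  apply: eq_bigl => x; rewrite Uv setU11 andbT; congr (_ && _).
  by apply/eqP/idP => [<-|vx]; rewrite ?setD11 ?setU1K.
have : (1 - p) * (\sum_(x | U x && (v \in x)) m x) <= p * (\sum_(x | U x && (v \notin x)) m x).
  rewrite E !mulr_sumr; apply: ler_sum => x /andP[_ vx]; exact: m_dom.
set a := \sum_(x | _ && (_ \in _)) _; set b := \sum_(x | _ && _) _.
lra.
Qed.

Lemma marginal_le v W x : v \notin W -> marginal v W x <= p.
Proof.
move=> vW; rewrite /marginal /cond.
set D := \sum_(y | _) m y.
have [->|D0] := eqVneq D 0; first by rewrite invr0 mulr0.
have Dp : 0 < D by rewrite lt_neqAle eq_sym D0 sumr_ge0.
rewrite ler_pdivrMr//.
have := @dominated_insert (fun y => y :&: W == x :&: W) v; rewrite -/D => h.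
apply: le_trans (h _); last first.
  move=> y; congr (_ == _); apply/setP => z; rewrite !inE.
  by case: eqP => [->|//]; rewrite (negPf vW) !andbF.
rewrite big_mkcondr/=; apply: ler_sum => y _.
by rewrite /contains sub1set; case: ifP; rewrite ?mulr1 ?mulr0.
Qed.

Lemma moment_le B : \sum_x m x * contains B x <= p ^+ #|B| * \sum_x m x.
Proof.
have [k] := ubnP #|B|; elim: k B => // k IH B; rewrite ltnS => Bk; have [->|[v vB]] := set_0Vmem B.
  rewrite cards0 expr0 mul1r; apply: ler_sum => x _.
  by rewrite /contains sub0set mulr1.
rewrite (cardsD1 v) vB add1n exprS -mulrA.
have := @dominated_insert (fun x : {set V} => B :\ v \subset x) v.
have E (C : {set V}) : \sum_x m x * contains C x = \sum_(x : {set V} | C \subset x) m x.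
  rewrite [RHS]big_mkcond/=; apply: eq_bigr => x _; rewrite /contains.
  by case: ifP; rewrite ?mulr1 ?mulr0.
have e : \sum_(x : {set V} | (B :\ v \subset x) && (v \in x)) m x = \sum_x m x * contains B x.
  rewrite E; apply: eq_bigl => x.
  by rewrite -{2}(setD1K vB) subUset sub1set andbC.
rewrite e -E => h.
have hU (x : {set V}) : (B :\ v \subset v |: x) = (B :\ v \subset x).
  apply/idP/idP => [h'|h']; last exact: fintype.subset_trans h' (subsetUr _ _).
  apply/fintype.subsetP => z zB; have /fintype.subsetP/(_ _ zB) := h'.
  by move: zB; rewrite !inE => /andP[/negPf-> _].
apply: le_trans (h hU) _.
apply: ler_wpM2l => //; apply: IH.
by rewrite (cardsD1 v) vB in Bk.
Qed.

End Domination.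
End ConditionalExpectation.

(** * Telescoping products *)

Section Telescoping.
Import boot.finset.
Variables (R : realType) (V : finType).

(** Replace the coordinates of [S] by their marginals one at a time.  Only the
    pairs [(B, v)] along one ordering of [S] occur; summing over all of them
    costs a constant factor and spares the choice of an ordering. *)
Lemma product_telescope (p : R) (q : V -> R) (J : {set V} -> R) (S : {set V}) :
  0 <= p -> (forall v, v \in S -> 0 <= q v <= p) -> J set0 = 1 ->
  `|J S - \prod_(v in S) q v| <=
  \sum_(t : {set V} * V | (t.2 \notin t.1) && (t.2 |: t.1 \subset S))
    p ^+ (#|S|.-1 - #|t.1|) * `|J (t.2 |: t.1) - J t.1 * q t.2|.
Proof.
move=> p0 + J0; have [k] := ubnP #|S|; elim: k S => // k IH S; rewrite ltnS => Sk qS.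
have [->|[v vS]] := set_0Vmem S.
  by rewrite J0 big_set0 subrr normr0 sumr_ge0// => t _; rewrite mulr_ge0 ?exprn_ge0.
set S' := S :\ v; have cS : #|S| = #|S'|.+1 by rewrite (cardsD1 v) vS.
have sS' : S' \subset S by exact: subD1set.
have {IH} := IH S'; rewrite -cS => /(_ Sk) IH.
have {}IH := IH (fun u uS => qS u (fintype.subsetP sS' u uS)).
rewrite (bigD1 (S', v))/=; last by rewrite setD11 setD1K// subxx.
have -> : (#|S|.-1 - #|S'| = 0)%N by rewrite cS subnn.
rewrite expr0 mul1r setD1K// (big_setD1 v)//=.
have /andP[qv0 qvp] := qS _ vS.
have -> : J S - q v * \prod_(u in S') q u =
    (J S - J S' * q v) + q v * (J S' - \prod_(u in S') q u) by ring.
apply: le_trans (ler_normD _ _) _; apply: lerD => //.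
rewrite normrM (ger0_norm qv0).
apply: le_trans (ler_pM qv0 _ qvp IH) _ => //.
rewrite mulr_sumr big_mkcond [leRHS]big_mkcond/=; apply: ler_sum => -[B u] _ /=.
case: ifPn => [/andP[uB uBS]|_]; last first.
  by case: ifP => // _; rewrite mulr_ge0 ?exprn_ge0.
rewrite uB (fintype.subset_trans uBS sS')/= xpair_eqE negb_and.
have -> : (u != v) = true.
  apply/eqP => uv; have := fintype.subsetP uBS u; rewrite uv !inE !eqxx/=.
  by move=> /(_ isT).
rewrite orbT mulrA -exprS.
have lBS : (#|B| < #|S'|)%N.
  by have := subset_leq_card uBS; rewrite cardsU1 uB add1n.
rewrite cS/= (_ : (#|S'|.-1 - #|B|).+1 = #|S'| - #|B|)%N//.
by case: #|S'| lBS => // s; rewrite ltnS => /subSn ->.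
Qed.

End Telescoping.

(** * Random labellings *)

Section Labels.
Import boot.finset.
Variables (R : realType) (V : finType) (M : nat).
Local Notation labelling := {ffun V -> 'I_M}.
Implicit Types (L : labelling) (T : {set V}) (u v : V).

Definition relabel L u k : labelling := [ffun v => if v == u then k else L v].

Definition lower (i : nat) L : {set V} := [set v | L v < i]%N.
Definition layer (i : nat) L : {set V} := [set v | L v == i :> nat].

Lemma relabel_id L u : relabel L u (L u) = L.
Proof. by apply/ffunP => v; rewrite ffunE; case: eqP => [->|]. Qed.

Lemma relabelK L u k k' : relabel (relabel L u k) u k' = relabel L u k'.
Proof. by apply/ffunP => v; rewrite !ffunE; case: eqP. Qed.

Lemma lower_relabel i L u (k : 'I_M) : (i <= L u)%N -> (i <= k)%N ->
  lower i (relabel L u k) = lower i L.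
Proof.
move=> iL ik; apply/setP => v; rewrite !inE ffunE; case: eqP => // ->.
by rewrite ltnNge ik ltnNge iL.
Qed.

Lemma lowerS i L : lower i.+1 L = lower i L :|: layer i L.
Proof. by apply/setP => v; rewrite !inE ltnS leq_eqVlt orbC. Qed.

(** A function that cannot distinguish the labels [i, ..., M - 1] at [u] has the
    same sum over each of the fibres [L u = k], [i <= k], and there are at most
    [M] of them. *)
Lemma resample1 (i : 'I_M) u (G : labelling -> R) : (forall L, 0 <= G L) ->
  (forall L (k : 'I_M), (i <= L u)%N -> (i <= k)%N -> G (relabel L u k) = G L) ->
  \sum_(L : labelling | (i <= L u)%N) G L <= M%:R * \sum_(L : labelling | L u == i) G L.
Proof.
move=> G0 Gu.
rewrite (partition_big (fun L : labelling => L u) (fun k : 'I_M => (i <= k)%N))//=.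
have e (k : 'I_M) : (i <= k)%N ->
    \sum_(L : labelling | (i <= L u)%N && (L u == k)) G L = \sum_(L : labelling | L u == i) G L.
  move=> ik; rewrite (reindex_onto (fun L => relabel L u k) (fun L => relabel L u i))/=.
    apply: eq_big => [L|L].
      rewrite ffunE eqxx ik eqxx/= relabelK.
      apply/eqP/eqP => [<-|Lu]; first by rewrite ffunE eqxx.
      by rewrite -Lu relabel_id.
    rewrite relabelK => /andP[_ /eqP Lu]; apply: Gu => //.
    by rewrite -Lu ffunE eqxx.
  by move=> L /andP[_ /eqP Lu]; rewrite relabelK -Lu relabel_id.
rewrite (eq_bigr _ e) sumr_const -[leLHS]mulr_natl.
apply: ler_wpM2r; first by rewrite sumr_ge0.
by rewrite ler_nat -[leqRHS](card_ord M) max_card.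
Qed.

(** Passes from sets [T] that are outside [lower i L] to those lying in layer
    [i], at the price of a factor [M] for each point. *)
Lemma resample (i : 'I_M) T (G : labelling -> R) : (forall L, 0 <= G L) ->
  (forall u L (k : 'I_M), u \in T -> (i <= L u)%N -> (i <= k)%N ->
     G (relabel L u k) = G L) ->
  \sum_(L : labelling | T \subset ~: lower i L) G L <=
  M%:R ^+ #|T| * \sum_(L : labelling | T \subset layer i L) G L.
Proof.
have [n] := ubnP #|T|; elim: n T G => // n IH T G; rewrite ltnS => Tn G0 GT.
have [->|[u uT]] := set_0Vmem T.
  rewrite cards0 expr0 mul1r; under eq_bigl do rewrite sub0set.
  by under [leRHS]eq_bigl do rewrite sub0set.
set T' := T :\ u; have cT : #|T| = #|T'|.+1 by rewrite (cardsD1 u) uT.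
have sT (X : {set V}) : (T \subset X) = (T' \subset X) && (u \in X).
  by rewrite -{1}(setD1K uT) subUset sub1set andbC.
have h1 : \sum_(L : labelling | T \subset ~: lower i L) G L =
    \sum_(L : labelling | T' \subset ~: lower i L) (i <= L u)%N%:R * G L.
  rewrite big_mkcond [RHS]big_mkcond/=; apply: eq_bigr => L _.
  rewrite sT !inE -leqNgt; case: (_ \subset _) => //=.
  by case: leqP => _; rewrite ?mul1r ?mul0r.
have h2 : \sum_(L : labelling | T \subset layer i L) G L =
    \sum_(L : labelling | L u == i) (T' \subset layer i L)%:R * G L.
  rewrite big_mkcond [RHS]big_mkcond/=; apply: eq_bigr => L _.
  rewrite sT !inE andbC (_ : (L u == i :> nat) = (L u == i))//.
  by case: eqP => //= _; case: (_ \subset _); rewrite ?mul1r ?mul0r.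
rewrite h1 h2.
have Gge (b : bool) L : 0 <= b%:R * G L by rewrite mulr_ge0.
apply: le_trans (IH T' _ _ (fun L => Gge _ L) _) _ => //; first by rewrite -cT.
  move=> w L k; rewrite inE in_set1 => /andP[wu wT] iL ik; rewrite GT//; congr (_ * _).
  by rewrite ffunE eq_sym (negPf wu).
rewrite cT exprSr -mulrA; apply: ler_wpM2l; first exact: exprn_ge0.
have -> : \sum_(L : labelling | T' \subset layer i L) (i <= L u)%N%:R * G L =
    \sum_(L : labelling | (i <= L u)%N) (T' \subset layer i L)%:R * G L.
  rewrite big_mkcond [RHS]big_mkcond/=; apply: eq_bigr => L _.
  by case: (_ \subset _); case: (_ <= _)%N; rewrite ?mul1r ?mul0r.
apply: resample1 => [//|L k iL ik]; rewrite GT//; congr (_%:R * _).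
congr (nat_of_bool _).
have e w : w \in T' -> (w \in layer i (relabel L u k)) = (w \in layer i L).
  by rewrite !inE ffunE => /andP[/negPf ->].
apply/fintype.subsetP/fintype.subsetP => h w wT; move: (h w wT);
  by rewrite e.
Qed.

(** The labels are independent and uniform: [T] lies in a given layer with
    probability [M ^- |T|]. *)
Lemma layer_count (i : 'I_M) T :
  (\sum_(L : labelling) (T \subset layer i L)%:R : R) * M%:R ^+ #|T| = M%:R ^+ #|V|.
Proof.
have -> : (\sum_(L : labelling) (T \subset layer i L)%:R : R) =
    \sum_(L : labelling) \prod_v (if v \in T then (L v == i)%:R else 1).
  apply: eq_bigr => L _; rewrite -big_mkcond/=.
  case: fintype.subsetP => [h|h].
    by rewrite big1// => v vT; have := h _ vT; rewrite inE => /eqP/val_inj ->; rewrite eqxx.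
  have /exists_inP[v vT vL] : [exists v in T, L v != i].
    apply: contra_notT h => /exists_inPn h v vT; have := h v vT; rewrite negbK inE => /eqP ->.
    by rewrite eqxx.
  by rewrite (bigD1 v)//= (negPf vL) mul0r.
rewrite -(bigA_distr_bigA (fun v k => if v \in T then (k == i)%:R else 1 : R))/=.
have -> : M%:R ^+ #|T| = \prod_v (if v \in T then M%:R else 1) :> R.
  by rewrite -big_mkcond/= prodr_const.
rewrite -big_split/= -[RHS]prodr_const; apply: eq_bigr => v _; case: ifP => _.
  rewrite (bigD1 i)//= eqxx big1 ?addr0 ?mul1r// => k ki.
  by rewrite (negPf ki).
by rewrite mulr1 sumr_const card_ord.
Qed.

Lemma lower_count i u : (i <= M)%N ->
  (\sum_(L : labelling) (u \in lower i L)%:R : R) * M%:R = i%:R * M%:R ^+ #|V|.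
Proof.
move=> iM.
have -> : (\sum_(L : labelling) (u \in lower i L)%:R : R) =
    \sum_(L : labelling) \prod_v (if v == u then (L v < i)%N%:R else 1).
  by apply: eq_bigr => L _; rewrite -big_mkcond/= big_pred1_eq inE.
rewrite -(bigA_distr_bigA (fun v (k : 'I_M) => if v == u then (k < i)%N%:R else 1 : R))/=.
rewrite (bigD1 u)//= eqxx.
rewrite [X in _ * X * _](eq_bigr (fun=> M%:R)); last first.
  by move=> v vu; rewrite (negPf vu) sumr_const card_ord.
have -> : \sum_(k : 'I_M) (k < i)%N%:R = i%:R :> R.
  rewrite -natr_sum; congr (_%:R).
  rewrite -(big_mkord xpredT (fun k => nat_of_bool (k < i)%N)).
  rewrite (big_cat_nat _ iM)//= [X in (_ + X)%N]big_nat_cond [X in (_ + X)%N]big1 ?addn0.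
    rewrite big_nat (eq_bigr (fun=> 1%N)) -?big_nat ?sum_nat_const_nat ?subn0 ?muln1//.
    by move=> k /andP[_ ->].
  by move=> k /andP[/andP[ik _] _]; rewrite ltnNge ik.
rewrite -mulrA; congr (_ * _).
rewrite prodr_const -exprSr; congr (_ ^+ _).
by rewrite [RHS](cardD1 u) inE add1n; congr (_.+1); apply: eq_card => v; rewrite !inE andbT.
Qed.

End Labels.

(** * Degrees of a weighted uniform hypergraph *)

Section Degrees.
Import boot.finset.
Variables (R : realType) (V : finType) (r : nat) (c : {set V} -> R).
Hypotheses (c_ge0 : forall S, 0 <= c S) (c_unif : forall S, c S != 0 -> #|S| = r).
Implicit Types (B S T : {set V}) (v : V).

(** The value at the all-ones vector of the derivative along [T] of the
    polynomial with coefficients [c]. *)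
Definition degree T := \sum_(S : {set V} | T \subset S) c S.

Lemma degree_ge0 T : 0 <= degree T.
Proof. exact: sumr_ge0. Qed.

Lemma degree_card T : degree T != 0 -> (#|T| <= r)%N.
Proof.
move=> DT; have [S TS cS] : exists2 S : {set V}, T \subset S & c S != 0.
  have [|] := pselect (exists2 S : {set V}, T \subset S & c S != 0) => // h.
  case/negP: DT; apply/eqP/big1 => S TS; apply/eqP.
  by apply: contra_notT h => cS; exists S.
by rewrite -(c_unif cS); exact: subset_leq_card.
Qed.

(** Each edge [S] containing [v |: T] is counted once for each admissible [B]
    inside [S], so at most [2 ^ r] times. *)
Lemma degree_extensions T v :
  \sum_(B : {set V} | (T \subset B) && (v \notin B)) degree (v |: B) <=
  2 ^+ r * degree (v |: T).
Proof.
rewrite /degree; under eq_bigr do rewrite big_mkcond.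
rewrite exchange_big/= mulr_sumr [leRHS]big_mkcond/=.
apply: ler_sum => S _; rewrite -big_mkcondr/=.
have [->|cS] := eqVneq (c S) 0; first by rewrite big1// mulr0; case: ifP.
case: ifPn => TS; last first.
  rewrite big_pred0// => B; apply/negP => /andP[/andP[TB vB] BS]; case/negP: TS.
  by apply: fintype.subset_trans BS; rewrite setUS.
rewrite sumr_const -[leLHS]mulr_natl; apply: ler_wpM2r => //.
rewrite -natrX ler_nat -(c_unif cS) -card_powerset; apply: subset_leq_card.
apply/fintype.subsetP => B; rewrite inE => /andP[_ /(fintype.subset_trans _)]; apply.
exact: subsetUr.
Qed.

Variables (rho kappa : R).
Hypotheses (rho_gt0 : 0 < rho) (kappa_ge0 : 0 <= kappa)
  (degree_le : forall T, T != set0 -> degree T <= kappa * rho ^+ (#|T| - 1)).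

(** Group the sets [B'] by their intersection [T] with [B]: the decay of the
    degrees at rate [rho ^ |T|] cancels the factor [rho ^- |T|], and only the
    number of subsets of edges remains. *)
Lemma degree_correlation v :
  \sum_(B : {set V} | v \notin B) \sum_(B' : {set V} | v \notin B')
    degree (v |: B) * degree (v |: B') * rho ^- #|B :&: B'| <=
  8 ^+ r * kappa ^+ 2.
Proof.
have vT T : v |: T != set0 by apply/set0Pn; exists v; rewrite setU11.
have inner B : v \notin B -> \sum_(B' : {set V} | v \notin B')
    degree (v |: B') * rho ^- #|B :&: B'| <= 2 ^+ #|B| * (2 ^+ r * kappa).
  move=> vB; rewrite (partition_big (fun B' => B :&: B') (mem (powerset B)))/=; last first.
    by move=> B' _; rewrite inE subsetIl.
  rewrite -natrX -card_powerset mulr_natl -sumr_const.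
  apply: ler_sum => T; rewrite inE => TB.
  have vNT : v \notin T by apply: contra vB => /(fintype.subsetP TB).
  apply: (@le_trans _ _ (2 ^+ r * degree (v |: T) * rho ^- #|T|)).
    apply: (@le_trans _ _ ((\sum_(B' : {set V} | (T \subset B') && (v \notin B'))
        degree (v |: B')) * rho ^- #|T|)); last first.
      by apply: ler_wpM2r (degree_extensions T v); rewrite invr_ge0 exprn_ge0// ltW.
    rewrite mulr_suml big_mkcond [leRHS]big_mkcond/=; apply: ler_sum => B' _.
    case: ifPn => [/andP[vB' /eqP <-]|_]; first by rewrite subsetIr vB'.
    case: ifP => // _; apply: mulr_ge0; first exact: degree_ge0.
    by rewrite invr_ge0 exprn_ge0// ltW.
  rewrite -mulrA; apply: ler_wpM2l; first exact: exprn_ge0.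
  rewrite ler_pdivrMr ?exprn_gt0//.
  by have := degree_le (vT T); rewrite cardsU1 vNT add1n subn1.
apply: (@le_trans _ _ (\sum_(B : {set V} | (set0 \subset B) && (v \notin B))
    degree (v |: B) * (4 ^+ r * kappa))).
  rewrite big_mkcond [leRHS]big_mkcond/=; apply: ler_sum => B _; rewrite sub0set/=.
  case: ifP => // vB; under eq_bigr do rewrite -mulrA; rewrite -mulr_sumr.
  have [->|DB] := eqVneq (degree (v |: B)) 0; first by rewrite !mul0r.
  apply: ler_wpM2l; first exact: degree_ge0.
  apply: le_trans (inner B vB) _; rewrite mulrA; apply: ler_wpM2r => //.
  have -> : (4 : R) = 2 * 2 by rewrite -natrM.
  rewrite exprMn; apply: ler_wpM2r; first exact: exprn_ge0.
  rewrite ler_eXn2l ?ltr1n//; apply: leq_trans (degree_card DB).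
  by rewrite subset_leq_card// subsetUr.
rewrite -mulr_suml.
apply: (@le_trans _ _ ((2 ^+ r * kappa) * (4 ^+ r * kappa))).
  apply: ler_wpM2r; first by rewrite mulr_ge0// exprn_ge0.
  apply: le_trans (degree_extensions _ _) _; apply: ler_wpM2l; first exact: exprn_ge0.
  by have := degree_le (vT set0); rewrite setU0 cards1 subnn expr0 mulr1.
have -> : (8 : R) = 2 * 4 by rewrite -natrM.
by rewrite exprMn expr2 mulrACA.
Qed.

End Degrees.

(** * Pinning a small set of coordinates *)

Section Pinning.
Import boot.finset.
Variables (R : realType) (V : finType) (r : nat) (c : {set V} -> R).
Hypotheses (c_ge0 : forall S, 0 <= c S) (c_unif : forall S, c S != 0 -> #|S| = r).
Variables (m : {set V} -> R) (p : R).
Hypotheses (m_ge0 : forall x, 0 <= m x) (m_sum : \sum_x m x = 1) (p_gt0 : 0 < p)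
  (m_dom : forall v (x : {set V}), v \notin x -> (1 - p) * m (v |: x) <= p * m x).
Variables (M : nat) (kappa : R).
Hypotheses (M_gt0 : (0 < M)%N) (kappa_gt0 : 0 < kappa).
Local Notation rho := (p / M%:R).
Hypothesis degree_le : forall T : {set V}, T != set0 ->
  degree c T <= kappa * rho ^+ (#|T| - 1).
Implicit Types (W B S T : {set V}) (v : V).
Local Notation labelling := {ffun V -> 'I_M}.
Implicit Types (L : labelling).

Let rho_gt0 : 0 < rho. Proof. by rewrite divr_gt0 ?ltr0n. Qed.
Let p_ge0 : 0 <= p := ltW p_gt0.
Let M0 : M%:R != 0 :> R. Proof. by rewrite pnatr_eq0 -lt0n. Qed.

Definition decoupling_error W x :=
  \sum_(S : {set V} | S \subset ~: W)
    c S * `|cond m W (contains R S) x - \prod_(v in S) marginal m v W x|.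

Lemma decoupling_error_le W :
  \sum_x m x * decoupling_error W x <=
  \sum_(t : {set V} * V | (t.2 \notin t.1) && (t.2 |: t.1 \subset ~: W))
    degree c (t.2 |: t.1) * p ^+ (r.-1 - #|t.1|) * defect m W t.1 t.2.
Proof.
pose e (x : {set V}) (t : {set V} * V) : R :=
  `|cond m W (contains R (t.2 |: t.1)) x
    - cond m W (contains R t.1) x * marginal m t.2 W x|.
apply: (@le_trans _ _ (\sum_x \sum_(t : {set V} * V |
    (t.2 \notin t.1) && (t.2 |: t.1 \subset ~: W))
    degree c (t.2 |: t.1) * p ^+ (r.-1 - #|t.1|) * (m x * e x t))); last first.
  by rewrite exchange_big/=; apply: ler_sum => t _; rewrite -mulr_sumr.
apply: ler_sum => x _.
under eq_bigr do rewrite mulrCA; rewrite -mulr_sumr.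
have [->|mx] := eqVneq (m x) 0; first by rewrite !mul0r.
apply: ler_wpM2l => //.
apply: (@le_trans _ _ (\sum_(S : {set V} | S \subset ~: W) \sum_(t : {set V} * V |
    (t.2 \notin t.1) && (t.2 |: t.1 \subset S))
    c S * (p ^+ (r.-1 - #|t.1|) * e x t))).
  apply: ler_sum => S SW; have [->|cS] := eqVneq (c S) 0.
    by rewrite mul0r sumr_ge0// => t _; rewrite mul0r.
  rewrite -mulr_sumr -(c_unif cS); apply: ler_wpM2l => //.
  have h := @product_telescope R V p (fun v => marginal m v W x)
    (fun T => cond m W (contains R T) x) S p_ge0.
  apply: h; last exact: cond_const.
  move=> v vS; rewrite marginal_ge0//=; apply: marginal_le => //.
  by have := fintype.subsetP SW v vS; rewrite inE.
rewrite (exchange_big_dep (fun t : {set V} * V =>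
  (t.2 \notin t.1) && (t.2 |: t.1 \subset ~: W)))/=; last first.
  by move=> S t SW /andP[-> tS]; exact: fintype.subset_trans tS SW.
apply: ler_sum => t /andP[tt tW].
rewrite -mulr_suml -mulrA; apply: ler_wpM2r.
  by rewrite /e mulr_ge0 ?exprn_ge0.
rewrite /degree big_mkcond [leRHS]big_mkcond/=; apply: ler_sum => S _.
rewrite tt/=; case: (_ |: _ \subset S); rewrite ?andbT ?andbF//.
by case: ifP.
Qed.

(** The weight [rho ^- |B|] is the inverse of the probability scale at which [B]
    is both in layer [i] and in the configuration, so that sets of all sizes
    contribute at the same order. *)
Definition layer_degree i v L x :=
  \sum_(B : {set V} | v \notin B)
    degree c (v |: B) * rho ^- #|B| * ((B \subset layer i L)%:R * contains R B x).

(** Expanding the square, the pair [(B, B')] costs [rho ^ |B :|: B'|]; against the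
    weights [rho ^- |B|] and [rho ^- |B'|] this leaves [rho ^- |B :&: B'|]. *)
Lemma layer_degree_moment (i : 'I_M) v :
  \sum_(L : labelling) \sum_x m x * layer_degree i v L x ^+ 2 <=
  M%:R ^+ #|V| * (8 ^+ r * kappa ^+ 2).
Proof.
pose w B := degree c (v |: B) * rho ^- #|B|.
have w0 B : 0 <= w B.
  by rewrite mulr_ge0 ?degree_ge0// invr_ge0 exprn_ge0// ltW.
have -> : \sum_(L : labelling) \sum_x m x * layer_degree i v L x ^+ 2 =
    \sum_(B : {set V} | v \notin B) \sum_(B' : {set V} | v \notin B') w B * w B' *
      ((\sum_(L : labelling) (B :|: B' \subset layer i L)%:R)
       * (\sum_x m x * contains R (B :|: B') x)).
  transitivity (\sum_(L : labelling) \sum_x \sum_(B : {set V} | v \notin B)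
      \sum_(B' : {set V} | v \notin B') w B * w B' *
      ((B :|: B' \subset layer i L)%:R * (m x * contains R (B :|: B') x))).
    apply: eq_bigr => L _; apply: eq_bigr => x _.
    rewrite expr2 /layer_degree mulr_suml mulr_sumr; apply: eq_bigr => B _.
    rewrite !mulr_sumr; apply: eq_bigr => B' _.
    by rewrite -containsU subUset -mulnb natrM -/(w B) -/(w B'); ring.
  under eq_bigr do rewrite exchange_big/=; rewrite exchange_big/=.
  apply: eq_bigr => B _.
  under eq_bigr do rewrite exchange_big/=; rewrite exchange_big/=.
  apply: eq_bigr => B' _.
  rewrite mulr_suml mulr_sumr; apply: eq_bigr => L _.
  by rewrite !mulr_sumr.
apply: le_trans (ler_wpM2l _ (degree_correlation c_ge0 c_unif rho_gt0 (ltW kappa_gt0)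
  degree_le v)); last exact: exprn_ge0.
rewrite mulr_sumr; apply: ler_sum => B _; rewrite mulr_sumr; apply: ler_sum => B' _.
have -> : \sum_(L : labelling) (B :|: B' \subset layer i L)%:R =
    M%:R ^+ #|V| * M%:R ^- #|B :|: B'| :> R.
  by rewrite -(layer_count R i (B :|: B')) mulfK// expf_neq0.
have -> : M%:R ^+ #|V| * (degree c (v |: B) * degree c (v |: B') * rho ^- #|B :&: B'|) =
    w B * w B' * (M%:R ^+ #|V| * M%:R ^- #|B :|: B'| * p ^+ #|B :|: B'|).
  have e : rho ^- #|B :&: B'| =
      rho ^- #|B| * rho ^- #|B'| * (M%:R ^- #|B :|: B'| * p ^+ #|B :|: B'|).
    rewrite [M%:R ^- _ * _]mulrC -expr_div_n -invfM -exprD -cardsUI exprD invfM.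
    by rewrite mulrAC mulVf ?mul1r// expf_neq0// gt_eqF.
  by rewrite e /w; ring.
apply: ler_wpM2l; first by rewrite mulr_ge0.
apply: ler_wpM2l; first by rewrite mulr_ge0 ?invr_ge0 ?exprn_ge0.
by have := moment_le p_ge0 m_dom (B :|: B'); rewrite m_sum mulr1.
Qed.

(** The point [v] is left out of the revealed sets: the marginals then stay at
    most [p] for every labelling, and do not depend on the label of [v]. *)
Definition increment i v L x :=
  marginal m v (lower i.+1 L :\ v) x - marginal m v (lower i L :\ v) x.

Definition increment_energy i :=
  \sum_(L : labelling) \sum_v \sum_x m x * increment i v L x ^+ 2.

(** The energies of successive layers telescope to a second moment of marginals,
    which are at most [p]; one of [N] layers has at most the average energy. *)
Lemma quiet_layer N : (0 < N)%N -> exists2 i, (i < N)%N &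
  increment_energy i <= M%:R ^+ #|V| * (#|V|%:R * p ^+ 2) / N%:R.
Proof.
move=> N0; apply: contrapT => h.
have {}h i : (i < N)%N -> M%:R ^+ #|V| * (#|V|%:R * p ^+ 2) / N%:R < increment_energy i.
  by move=> iN; rewrite ltNge; apply/negP => h'; apply: h; exists i.
pose E i := \sum_(L : labelling) \sum_v \sum_x m x * marginal m v (lower i L :\ v) x ^+ 2.
have Eincr i : increment_energy i = E i.+1 - E i.
  rewrite -sumrB; apply: eq_bigr => L _; rewrite -sumrB; apply: eq_bigr => v _.
  by apply: marginal_variance => //; rewrite lowerS setSD// subsetUl.
have : \sum_(i < N) increment_energy i <= M%:R ^+ #|V| * (#|V|%:R * p ^+ 2).
  under eq_bigr do rewrite Eincr.
  rewrite -(big_mkord xpredT (fun i => E i.+1 - E i)).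
  rewrite telescope_sumr//.
  apply: (@le_trans _ _ (E N)).
    rewrite gerBl; apply: sumr_ge0 => L _; apply: sumr_ge0 => v _; apply: sumr_ge0 => x _.
    by rewrite mulr_ge0// exprn_ge0// marginal_ge0.
  rewrite /E; apply: (@le_trans _ _ (\sum_(L : labelling) \sum_(v : V) p ^+ 2)).
    apply: ler_sum => L _; apply: ler_sum => v _.
    apply: (@le_trans _ _ (\sum_x m x * p ^+ 2)); last by rewrite -mulr_suml m_sum mul1r.
    apply: ler_sum => x _; apply: ler_wpM2l => //.
    apply: lerXn2r; rewrite ?nnegrE ?marginal_ge0//.
    by apply: marginal_le => //; rewrite setD11.
  by rewrite !sumr_const card_ffun card_ord mulr_natl -natrX mulr_natl.
apply/negP; rewrite -ltNge.
have -> : M%:R ^+ #|V| * (#|V|%:R * p ^+ 2) =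
    \sum_(i < N) (M%:R ^+ #|V| * (#|V|%:R * p ^+ 2) / N%:R).
  by rewrite sumr_const card_ord -[RHS]mulr_natr divfK// pnatr_eq0 -lt0n.
case: N N0 h => // N _ h.
apply: ltr_sum => [|i _]; [|exact: h].
by apply/hasP; exists ord0 => //; exact: mem_index_enum.
Qed.

(** The defect given [lower i L :\ v] does not see the labels of [B] above [i],
    so [B] may be moved into layer [i], where [defect_le] applies. *)
Lemma pair_decoupling (i : 'I_M) B v : v \notin B ->
  \sum_(L : labelling | v |: B \subset ~: lower i L) defect m (lower i L) B v <=
  M%:R ^+ #|B| * \sum_(L : labelling | B \subset layer i L)
    \sum_x m x * (contains R B x * `|increment i v L x|).
Proof.
move=> vB.
apply: (@le_trans _ _ (\sum_(L : labelling | B \subset ~: lower i L)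
    defect m (lower i L :\ v) B v)).
  rewrite big_mkcond [leRHS]big_mkcond/=; apply: ler_sum => L _.
  rewrite subUset sub1set; have [vL|vL] /= := boolP (v \in ~: lower i L).
    by rewrite (setDidPl _)// disjoint_sym disjoints1 -in_setC.
  by case: ifP => // _; exact: defect_ge0.
apply: le_trans (resample _ _) _ => [L|u L k uB iL ik|].
- exact: defect_ge0.
- by rewrite lower_relabel.
apply: ler_wpM2l; first exact: exprn_ge0.
apply: ler_sum => L BL; apply: defect_le => //; rewrite lowerS.
  by rewrite setSD// subsetUl.
by rewrite subsetD1 vB andbT (fintype.subset_trans BL)// subsetUr.
Qed.

(** The factors [M ^ |B|] from [pair_decoupling] and [p ^ (r - 1 - |B|)] from the
    telescoping combine to [p ^ (r - 1)] times the weights of [layer_degree]. *)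
Lemma averaged_decoupling_layer (i : 'I_M) :
  \sum_(L : labelling) \sum_x m x * decoupling_error (lower i L) x <=
  p ^+ r.-1 * \sum_(L : labelling) \sum_v \sum_x
    m x * (layer_degree i v L x * `|increment i v L x|).
Proof.
pose I L B v := \sum_x m x * (contains R B x * `|increment i v L x|).
have I0 L B v : 0 <= I L B v.
  by apply: sumr_ge0 => x _; rewrite !mulr_ge0 ?contains_ge0.
apply: le_trans (ler_sum _ (fun L _ => decoupling_error_le (lower i L))) _.
under eq_bigr do rewrite big_mkcondr/=.
rewrite exchange_big/=.
apply: (@le_trans _ _ (\sum_(t : {set V} * V | t.2 \notin t.1) p ^+ r.-1 *
   \sum_(L : labelling) degree c (t.2 |: t.1) * rho ^- #|t.1| *
      ((t.1 \subset layer i L)%:R * I L t.1 t.2))).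
  apply: ler_sum => -[B v] /= vB; rewrite -big_mkcond/= -!mulr_sumr.
  have [->|DB] := eqVneq (degree c (v |: B)) 0; first by rewrite !mul0r mulr0.
  have cB : (#|B| <= r.-1)%N.
    have := degree_card c_unif DB; rewrite cardsU1 vB add1n.
    by case: (r) => // r'; rewrite ltnS.
  have -> : p ^+ r.-1 = p ^+ (r.-1 - #|B|) * p ^+ #|B| by rewrite -exprD subnK.
  have -> (X : R) : p ^+ (r.-1 - #|B|) * p ^+ #|B| * (degree c (v |: B) * rho ^- #|B| * X) =
      degree c (v |: B) * p ^+ (r.-1 - #|B|) * (M%:R ^+ #|B| * X).
    rewrite expr_div_n invf_div.
    have pB : p ^+ #|B| != 0 by rewrite expf_neq0// gt_eqF.
    by field.
  apply: ler_wpM2l; first by rewrite mulr_ge0 ?degree_ge0 ?exprn_ge0.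
  apply: le_trans (pair_decoupling i vB) _.
  apply: ler_wpM2l; first exact: exprn_ge0.
  rewrite big_mkcond/=; apply: ler_sum => L _.
  by case: ifP; rewrite ?mul1r ?mul0r.
rewrite -mulr_sumr; apply: ler_wpM2l; first exact: exprn_ge0.
rewrite exchange_big/=; apply: ler_sum => L _.
rewrite -(pair_big_dep xpredT (fun B v => v \notin B) (fun B v =>
  degree c (v |: B) * rho ^- #|B| * ((B \subset layer i L)%:R * I L B v)))/=.
rewrite (exchange_big_dep xpredT)//=; apply: ler_sum => v _.
rewrite /I /layer_degree.
under eq_bigr do rewrite !mulr_sumr.
rewrite exchange_big/=; apply: ler_sum => x _.
rewrite mulr_suml mulr_sumr; apply: ler_sum => B _.
rewrite le_eqVlt; apply/orP; left; apply/eqP; ring.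
Qed.

(** Cauchy-Schwarz between [layer_degree] and [increment], in the form of the
    inequality of arithmetic and geometric means. *)
Lemma averaged_decoupling (i : 'I_M) a : (0 < a)%N -> (0 < r)%N ->
  increment_energy i <= M%:R ^+ #|V| * (#|V|%:R * p ^+ 2) / (a ^ 2)%:R ->
  \sum_(L : labelling) \sum_x m x * decoupling_error (lower i L) x <=
  M%:R ^+ #|V| * (p ^+ r * (#|V|%:R * kappa * (8 ^+ r + 1) / (2 * a%:R))).
Proof.
move=> a0 r0 quiet; have aR : 0 < a%:R :> R by rewrite ltr0n.
apply: le_trans (averaged_decoupling_layer i) _.
(* Up to a constant, this weight equalizes the two second moments. *)
pose th := p / (kappa * a%:R); have th0 : 0 < th by rewrite divr_gt0// mulr_gt0.
have amgm (h d : R) : h * `|d| <= (th * h ^+ 2 + d ^+ 2 / th) / 2.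
  rewrite -(real_normK (num_real d)); move: `|d| => d'.
  have : 0 <= th * (h - d' / th) ^+ 2 by rewrite mulr_ge0 ?sqr_ge0 ?ltW.
  rewrite (_ : th * (h - d' / th) ^+ 2 = th * h ^+ 2 + d' ^+ 2 / th - 2 * (h * d')).
    by move: (d' ^+ 2 / th) (th * h ^+ 2) (h * d') => *; lra.
  by field; rewrite gt_eqF.
have sum1 : \sum_(L : labelling) \sum_v \sum_x m x * layer_degree i v L x ^+ 2 <=
    #|V|%:R * (M%:R ^+ #|V| * (8 ^+ r * kappa ^+ 2)).
  rewrite exchange_big/= mulr_natl -sumr_const; apply: ler_sum => v _.
  exact: layer_degree_moment.
have -> : p ^+ r = p ^+ r.-1 * p by rewrite -exprSr prednK.
rewrite -mulrA [leRHS]mulrCA; apply: ler_wpM2l; first exact: exprn_ge0.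
apply: (@le_trans _ _ ((th * (#|V|%:R * (M%:R ^+ #|V| * (8 ^+ r * kappa ^+ 2)))
  + (M%:R ^+ #|V| * (#|V|%:R * p ^+ 2) / (a ^ 2)%:R) / th) / 2)).
  apply: (@le_trans _ _ ((th * (\sum_(L : labelling) \sum_v \sum_x m x * layer_degree i v L x ^+ 2)
    + increment_energy i / th) / 2)); last first.
    by rewrite ler_pM2r ?invr_gt0// lerD// ?ler_pM2l// ler_pM2r// invr_gt0.
  rewrite /increment_energy mulr_sumr mulr_suml -big_split/= mulr_suml.
  apply: ler_sum => L _.
  rewrite mulr_sumr mulr_suml -big_split/= mulr_suml; apply: ler_sum => v _.
  rewrite mulr_sumr mulr_suml -big_split/= mulr_suml; apply: ler_sum => x _.
  have e (k h d : R) : (th * (k * h) + k * d / th) / 2 = k * ((th * h + d / th) / 2) by ring.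
  rewrite e.
  exact: ler_wpM2l.
rewrite natrX /th le_eqVlt; apply/orP; left; apply/eqP; field.
by rewrite !gt_eqF.
Qed.

(** Some labelling does at least as well as the average: a quiet layer controls
    the decoupling error, and a given point has label below [i < a ^ 2] with
    probability at most [a ^ 2 / M]. *)
Lemma exists_pinning a : (0 < a)%N -> (0 < r)%N -> (a ^ 2 <= M)%N -> exists W,
  \sum_x m x * decoupling_error W x
  + p ^+ r * (\sum_(S : {set V} | ~~ (S \subset ~: W)) c S) <=
  p ^+ r * (#|V|%:R * kappa * (8 ^+ r + 1) / (2 * a%:R)
            + (\sum_S c S) * (r * a ^ 2)%:R / M%:R).
Proof.

move=> a0 r0 aM.
have a20 : (0 < a ^ 2)%N by rewrite expn_gt0 a0.
have [k ka quiet] := quiet_layer a20.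
have kM : (k < M)%N := leq_trans ka aM.
pose i := Ordinal kM.
have dec := averaged_decoupling (i := i) a0 r0 quiet.
have MV : 0 < M%:R ^+ #|V| :> R by rewrite exprn_gt0// ltr0n.
apply: contrapT => h.
set bound := p ^+ r * (_ + _) in h.
have {}h (L : labelling) : bound < \sum_x m x * decoupling_error (lower i L) x
    + p ^+ r * (\sum_(S : {set V} | ~~ (S \subset ~: lower i L)) c S).
  by rewrite ltNge; apply/negP => h'; apply: h; exists (lower i L).
have touch : \sum_(L : labelling) \sum_(S : {set V} | ~~ (S \subset ~: lower i L)) c S <=
    M%:R ^+ #|V| * ((\sum_S c S) * (r * a ^ 2)%:R / M%:R).
  apply: (@le_trans _ _ (\sum_(S : {set V}) \sum_(u in S) c S *
      (\sum_(L : labelling) (u \in lower i L)%:R))).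
    under eq_bigr do rewrite big_mkcond; rewrite exchange_big/=.
    apply: ler_sum => S _; under [leRHS]eq_bigr do rewrite mulr_sumr.
    rewrite exchange_big/=; apply: ler_sum => L _; rewrite -mulr_sumr.
    case: ifPn => [/subsetPn[u uS uL]|_]; last by rewrite mulr_ge0// sumr_ge0.
    rewrite -[leLHS]mulr1; apply: ler_wpM2l => //; rewrite (bigD1 u)//=.
    by rewrite inE negbK in uL; rewrite uL lerDl sumr_ge0.
  have cnt u : \sum_(L : labelling) (u \in lower i L)%:R <=
      M%:R ^+ #|V| * ((a ^ 2)%:R / M%:R) :> R.
    have e := lower_count R u (ltnW (ltn_ord i)).
    rewrite mulrA ler_pdivlMr ?ltr0n// e mulrC; apply: ler_wpM2l; first exact: ltW.
    by rewrite ler_nat ltnW.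
  rewrite -!mulrA mulr_suml mulr_sumr; apply: ler_sum => S _.
  have [->|cS] := eqVneq (c S) 0.
    by rewrite mul0r mulr0 big1// => u _; rewrite mul0r.
  apply: (@le_trans _ _ (\sum_(u in S) c S * (M%:R ^+ #|V| * ((a ^ 2)%:R / M%:R)))).
    by apply: ler_sum => u _; apply: ler_wpM2l.
  rewrite sumr_const (c_unif cS) -[leLHS]mulr_natl natrM.
  rewrite le_eqVlt; apply/orP; left; apply/eqP; ring.
have : \sum_(L : labelling) bound < \sum_(L : labelling)
    (\sum_x m x * decoupling_error (lower i L) x
    + p ^+ r * (\sum_(S : {set V} | ~~ (S \subset ~: lower i L)) c S)).
  apply: ltr_sum => [|L _]; last exact: h.
  apply/hasP; exists [ffun=> i] => //; exact: mem_index_enum.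
apply/negP; rewrite -leNgt big_split/= -mulr_sumr.
rewrite sumr_const card_ffun card_ord -[leRHS]mulr_natl natrX /bound mulrDr mulrDr.
apply: lerD => //; rewrite [leRHS]mulrCA; apply: ler_wpM2l => //.
exact: exprn_ge0.
Qed.

End Pinning.

(** * Relative entropy of the conditioned law *)

Section RelativeEntropy.
Import boot.finset.
Variables (R : realType) (V : finType).
Implicit Types (W S x y : {set V}) (v : V).

(** Convexity of [x * ln x]; for [a = 0] it relies on [ln 0 = 0]. *)
Lemma xlnx_ge (a b : R) : 0 <= a -> 0 < b -> a - b <= a * ln (a / b).
Proof.
move=> a0 b0; have [->|an0] := eqVneq a 0; first by rewrite mul0r sub0r oppr_le0 ltW.
have ap : 0 < a by rewrite lt_neqAle eq_sym an0.
have ba : 0 < b / a by rewrite divr_gt0.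
have h : ln (b / a) <= b / a - 1.
  by have := expR_ge1Dx (ln (b / a)); rewrite lnK ?posrE// lerBrDl.
have -> : ln (a / b) = - ln (b / a) by rewrite -lnV ?posrE// invf_div.
have -> : a - b = a * (1 - b / a) by field.
by apply: ler_wpM2l => //; rewrite lerNr opprB.
Qed.

Definition bernoulli_KL (p q : R) := q * ln (q / p) + (1 - q) * ln ((1 - q) / (1 - p)).

Lemma bernoulli_KL_ge0 p q : 0 < p < 1 -> 0 <= q <= 1 -> 0 <= bernoulli_KL p q.
Proof.
move=> /andP[p0 p1] /andP[q0 q1].
have h1 := xlnx_ge q0 p0.
have h2 : 1 - q - (1 - p) <= (1 - q) * ln ((1 - q) / (1 - p)).
  by apply: xlnx_ge; rewrite ?subr_ge0 ?subr_gt0.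
rewrite /bernoulli_KL; move: h1 h2.
by move: (q * _) ((1 - q) * _) => *; lra.
Qed.

Lemma bernoulli_KL_refl p : 0 < p < 1 -> bernoulli_KL p p = 0.
Proof.
move=> /andP[p0 p1]; rewrite /bernoulli_KL !divff ?ln1 ?mulr0 ?addr0//.
  by rewrite gt_eqF// subr_gt0.
by rewrite gt_eqF.
Qed.

Variables (p : R).
Hypotheses (p_gt0 : 0 < p) (p_lt1 : p < 1).

Definition product_weight x : R := \prod_v (if v \in x then p else 1 - p).

Lemma product_weight_gt0 x : 0 < product_weight x.
Proof. by apply: prodr_gt0 => v _; case: ifP; rewrite ?subr_gt0. Qed.

Lemma product_weight_insert v x : v \notin x ->
  (1 - p) * product_weight (v |: x) = p * product_weight x.
Proof.
move=> vx; rewrite /product_weight (bigD1 v)//= [in RHS](bigD1 v)//=.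
rewrite setU11 (negPf vx) mulrCA; congr (_ * (_ * _)).
by apply: eq_bigr => u uv; rewrite !inE (negPf uv).
Qed.

(** These are the weights of a probability law: the coordinates in [W] are
    independent of parameter [p], and given them the others are independent with
    parameters [q]. *)
Lemma sum_kernel W (q : V -> {set V} -> R) : (forall v, determined_by W (q v)) ->
  \sum_(x : {set V}) \prod_v (if v \in W then if v \in x then p else 1 - p
                  else if v \in x then q v x else 1 - q v x) = 1.
Proof.
move=> qW; rewrite (partition_big (fun x : {set V} => x :&: W) predT)//=.
pose F v (z : {set V}) := if v \in W then if v \in z then p else 1 - p
                          else if v \in z then 0 else 1 : R.
have inner z : \sum_(x : {set V} | x :&: W == z)
    \prod_v (if v \in W then if v \in x then p else 1 - p
             else if v \in x then q v x else 1 - q v x) = \prod_v F v z.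
  have [zW|zW] := boolP (z \subset W); last first.
    transitivity (0 : R); first apply: big_pred0 => x.
      by apply/negbTE; apply: contra zW => /eqP <-; exact: subsetIr.
    have /subsetPn[v vz vW] := zW.
    by rewrite (bigD1 v)//= /F (negbTE vW) vz mul0r.
  pose G v := if v \in W then if v \in z then p else 0 else q v z.
  pose H v := if v \in W then if v \in z then 0 else 1 - p else 1 - q v z.
  transitivity (\sum_(x : {set V}) \prod_v (if v \in x then G v else H v)).
    rewrite big_mkcond/=; apply: eq_bigr => x _; case: eqP => [xz|xz].
      apply: eq_bigr => v _; rewrite /G /H; case: ifP => vW.
        have -> : (v \in z) = (v \in x) by rewrite -xz inE vW andbT.
        by case: ifP.
      have e : x :&: W = z :&: W by rewrite -xz -setIA setIid.
      by rewrite (qW v x z e).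
    have [v vW vxz] : exists2 v, v \in W & (v \in x) != (v \in z).
      have [|] := pselect (exists2 v, v \in W & (v \in x) != (v \in z)) => // h.
      case: xz; apply/setP => v; rewrite inE; have [vW|vW] := boolP (v \in W).
        by rewrite andbT; apply/eqP; apply: contra_notT h => vxz; exists v.
      by rewrite andbF; apply/esym/negbTE; apply: contra vW; exact: fintype.subsetP.
    rewrite (bigD1 v)//= /G /H vW; move: vxz.
    by case: (v \in x); case: (v \in z); rewrite //= mul0r.
  rewrite -(bigA_distr 1 +%R G H)/=; apply: eq_bigr => v _; rewrite /G /H /F.
  have := fintype.subsetP zW v; case: (v \in W).
    by case: (v \in z); rewrite ?addr0 ?add0r.
  by case: (v \in z) => [/(_ isT)//|_]; rewrite addrC subrK.
rewrite (eq_bigr _ (fun z _ => inner z)).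
pose F1 v : R := if v \in W then p else 0.
pose F2 v : R := if v \in W then 1 - p else 1.
transitivity (\sum_(z : {set V}) \prod_v (if v \in z then F1 v else F2 v)).
  by apply: eq_bigr => z _; apply: eq_bigr => v _; rewrite /F /F1 /F2; do 2 case: ifP.
rewrite -(bigA_distr 1 +%R F1 F2)/= big1// => v _; rewrite /F1 /F2.
by case: ifP => _; rewrite ?add0r// addrC subrK.
Qed.

Variable A : pred {set V}.
Hypotheses (A_down : forall v x, A (v |: x) -> A x) (A0 : A set0).

Definition event_weight := \sum_(x | A x) product_weight x.
Definition conditioned x := (A x)%:R * product_weight x / event_weight.

Lemma event_weight_gt0 : 0 < event_weight.
Proof.
rewrite /event_weight (bigD1 set0)//=; apply: ltr_pwDl; first exact: product_weight_gt0.
by apply: sumr_ge0 => x _; rewrite ltW// product_weight_gt0.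
Qed.

Lemma conditioned_ge0 x : 0 <= conditioned x.
Proof.
by rewrite !mulr_ge0 ?ler0n ?invr_ge0// ltW ?product_weight_gt0 ?event_weight_gt0.
Qed.

Lemma conditioned_sum : \sum_x conditioned x = 1.
Proof.
rewrite -mulr_suml (eq_bigr (fun x => if A x then product_weight x else 0)).
  by rewrite -big_mkcond mulfV// gt_eqF// event_weight_gt0.
by move=> x _; case: (A x); rewrite ?mul1r ?mul0r.
Qed.

Lemma conditioned_dominated v x : v \notin x ->
  (1 - p) * conditioned (v |: x) <= p * conditioned x.
Proof.
move=> vx; rewrite /conditioned !mulrA ler_pM2r ?invr_gt0 ?event_weight_gt0//.
rewrite mulrAC product_weight_insert// [leRHS]mulrAC [leRHS]mulrC [leLHS]mulrC.
apply: ler_wpM2r; first by rewrite mulr_ge0// ltW// product_weight_gt0.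
by rewrite ler_nat; have := @A_down v x; case: (A (v |: x)) => // ->.
Qed.

Local Notation q := (marginal conditioned).
Local Notation m := conditioned.

Lemma marginal_gt0 v W x : m x != 0 -> v \in x -> 0 < q v W x.
Proof.
move=> mx vx; have mp : 0 < m x by rewrite lt_neqAle eq_sym mx conditioned_ge0.
rewrite /marginal /cond; apply: divr_gt0; rewrite (bigD1 x)//=; apply: ltr_pwDl.
- by rewrite /contains sub1set vx mulr1.
- by apply: sumr_ge0 => y _; rewrite mulr_ge0 ?conditioned_ge0 ?contains_ge0.
- by [].
- by apply: sumr_ge0 => y _; rewrite conditioned_ge0.
Qed.

Lemma marginal_lt1 v W x : m x != 0 -> v \notin x -> q v W x < 1.
Proof.
move=> mx vx; have mp : 0 < m x by rewrite lt_neqAle eq_sym mx conditioned_ge0.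
rewrite /marginal /cond ltr_pdivrMr ?mul1r; last first.
  rewrite (bigD1 x)//=; apply: ltr_pwDl => //.
  by apply: sumr_ge0 => y _; rewrite conditioned_ge0.
rewrite (bigD1 x)//= [ltRHS](bigD1 x)//=; apply: ltr_leD.
  by rewrite /contains sub1set (negPf vx) mulr0.
apply: ler_sum => y _; rewrite -[leRHS]mulr1; apply: ler_wpM2l; first exact: conditioned_ge0.
by rewrite /contains lern1 leq_b1.
Qed.

(** With [rho] the law of [sum_kernel] for the marginals of [m], the left-hand
    side is the mean of [ln (rho / product_weight)] under [m], which Gibbs'
    inequality bounds by the divergence [- ln event_weight] of [m] from the
    product law.  Gibbs' inequality is obtained from [t + 1 <= expR t]. *)
Lemma entropy_budget W :
  \sum_x m x * (\sum_(v | v \notin W) bernoulli_KL p (q v W x)) <= - ln event_weight.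
Proof.
pose Y v x : R := contains R [set v] x.
pose l1 v x := ln (q v W x / p).
pose l2 v x := ln ((1 - q v W x) / (1 - p)).
pose Sx x := \sum_(v | v \notin W) (Y v x * l1 v x + (1 - Y v x) * l2 v x).
have qW v : determined_by W (q v W) by exact: cond_determined.
have -> : \sum_x m x * (\sum_(v | v \notin W) bernoulli_KL p (q v W x)) = \sum_x m x * Sx x.
  under eq_bigr do rewrite mulr_sumr; under [RHS]eq_bigr do rewrite mulr_sumr.
  rewrite exchange_big [RHS]exchange_big/=; apply: eq_bigr => v _.
  have split (g : {set V} -> R) :
      \sum_x m x * (g x * l1 v x + (1 - g x) * l2 v x) =
      \sum_x m x * ((l1 v x - l2 v x) * g x) + \sum_x m x * l2 v x.
    by rewrite -big_split/=; apply: eq_bigr => x _; ring.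
  rewrite (split (Y v)); apply: etrans (split (q v W)) _.
  congr (_ + _).
  apply: (tower conditioned_ge0) => x y e.
  by rewrite /l1 /l2 (qW v x y e).
pose rho x := \prod_v (if v \in W then if v \in x then p else 1 - p
                  else if v \in x then q v W x else 1 - q v W x).
have rho_ge0 x : 0 <= rho x.
  apply: prodr_ge0 => v _; case: ifP => vW; case: ifP => vx;
    rewrite ?subr_ge0 ?(ltW p_gt0) ?(ltW p_lt1)//.
    exact/marginal_ge0/conditioned_ge0.
  apply: le_trans (marginal_le conditioned_ge0 (ltW p_gt0) conditioned_dominated x _) (ltW p_lt1).
  by rewrite vW.
have Z0 := event_weight_gt0.
have key x : m x * (Sx x + ln event_weight) <= rho x - m x.
  have [mx|mx] := eqVneq (m x) 0; first by rewrite mx mul0r subr0.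
  have Ax : A x by apply: contraNT mx => /negPf Ax; rewrite /conditioned Ax !mul0r.
  have -> : rho x - m x = m x * (expR (Sx x + ln event_weight) - 1).
    rewrite mulrBr mulr1; congr (_ - _); rewrite expRD lnK ?posrE// expR_sum.
    have -> : \prod_(v | v \notin W) expR (Y v x * l1 v x + (1 - Y v x) * l2 v x) =
        rho x / product_weight x.
      rewrite /rho /product_weight -prodf_div big_mkcond/=; apply: eq_bigr => v _.
      have [vW|vW] /= := boolP (v \in W).
        by rewrite mulfV//; case: ifP => _; rewrite gt_eqF// subr_gt0.
      rewrite /Y /contains sub1set; case: ifPn => vx.
        rewrite mul1r subrr mul0r addr0 lnK// posrE divr_gt0//.
        exact: marginal_gt0.
      rewrite mul0r subr0 mul1r add0r lnK// posrE divr_gt0// subr_gt0//.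
      exact: marginal_lt1.
    rewrite /conditioned Ax mul1r; field.
    by rewrite !gt_eqF// product_weight_gt0.
  apply: ler_wpM2l; first exact: conditioned_ge0.
  by rewrite lerBrDl expR_ge1Dx.
have : \sum_x m x * (Sx x + ln event_weight) <= \sum_x (rho x - m x).
  by apply: ler_sum => x _; exact: key.
rewrite sumrB (sum_kernel qW) conditioned_sum subrr.
under eq_bigr do rewrite mulrDr.
by rewrite big_split/= -mulr_suml conditioned_sum mul1r -lerBrDr sub0r.
Qed.

End RelativeEntropy.

Section ProductMoments.
Import boot.finset.

Lemma product_weight_contains (R : realType) (V : finType) (p : R) (S : {set V}) :
  \sum_x product_weight p x * contains R S x = p ^+ #|S|.
Proof.
pose F (v : V) := p; pose G v := if v \in S then 0 else 1 - p.
transitivity (\sum_(x : {set V}) \prod_v (if v \in x then F v else G v)).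
  apply: eq_bigr => x _; rewrite /contains /product_weight.
  case: fintype.subsetP => [Sx|Sx].
    rewrite mulr1; apply: eq_bigr => v _; rewrite /G.
    by have := Sx v; case: (v \in S) => [/(_ isT) ->|_].
  have /fintype.subsetPn[v vS vx] : ~~ (S \subset x) by apply/fintype.subsetP.
  by rewrite mulr0 [RHS](bigD1 v)//= (negPf vx) /G vS mul0r.
rewrite -(bigA_distr 1 +%R F G)/= -prodr_const [RHS]big_mkcond/=.
apply: eq_bigr => v _; rewrite /F /G; case: ifP => _; first by rewrite addr0.
by rewrite addrC subrK.
Qed.

End ProductMoments.

(** * The lower tail of a multilinear form *)

Section LowerTail.
Import boot.finset.
Variables (R : realType) (V : finType) (r : nat) (c : {set V} -> R).
Hypotheses (c_ge0 : forall S, 0 <= c S) (c_unif : forall S, c S != 0 -> #|S| = r).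
Implicit Types (W S x y : {set V}) (v : V).

Definition multilinear_eval (y : V -> R) := \sum_S c S * \prod_(v in S) y v.

Lemma multilinear_eval_indicator x :
  multilinear_eval (fun v => (v \in x)%:R) = \sum_S c S * contains R S x.
Proof.
apply: eq_bigr => S _; congr (_ * _); rewrite /contains.
case: fintype.subsetP => [h|h]; first by rewrite big1// => v /h ->.
have /subsetPn[v vS vx] : ~~ (S \subset x) by apply/fintype.subsetP.
by rewrite (bigD1 v)//= (negPf vx) mul0r.
Qed.

Lemma multilinear_eval_set0 : (0 < r)%N ->
  multilinear_eval (fun v => (v \in (set0 : {set V}))%:R) = 0.
Proof.
move=> r0; rewrite multilinear_eval_indicator big1// => S _.
rewrite /contains subset0; case: eqP => [S0|]; last by rewrite mulr0.
rewrite mulr1; apply/eqP; rewrite -[_ == _]negbK; apply/negP => /c_unif.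
by rewrite S0 cards0 => r0'; rewrite -r0' in r0.
Qed.

(** Outside a set of [m]-probability [eps] the error is at most [eps * E]; there
    the profile [qbar] is feasible and its divergence is at least [Phi].  On
    [W] the profile equals [p], which costs no divergence. *)
Lemma lower_tail_entropy (a M : nat) (p eps K eta Phi : R) :
  (0 < r)%N -> (0 < a)%N -> (a ^ 2 <= M)%N -> 0 < p < 1 -> 0 < eps -> 0 <= eta -> 0 < K ->
  0 < \sum_S c S ->
  K * (8 ^+ r + 1) <= eps ^+ 2 * a%:R -> 2 * (r * a ^ 2)%:R <= eps ^+ 2 * M%:R ->
  (forall T : {set V}, T != set0 ->
    degree c T <= K * (p / M%:R) ^+ (#|T| - 1) * ((\sum_S c S) / #|V|%:R)) ->
  0 <= Phi ->
  (forall q : V -> R, (forall v, 0 <= q v <= 1) ->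
     multilinear_eval q <= (eta + eps) * (p ^+ r * \sum_S c S) ->
     Phi <= \sum_v bernoulli_KL p (q v)) ->
  (1 - eps) * Phi <= - ln (event_weight p (fun x =>
    multilinear_eval (fun v => (v \in x)%:R) <= eta * (p ^+ r * \sum_S c S))).
Proof.
move=> r0 a0 aM /andP[p0 p1] eps0 eta0 K0 tot0 ha hM deg Phi0 hPhi.
set tot := \sum_S c S in tot0 deg hPhi *.
set A : pred {set V} := (X in event_weight p X).
set E := p ^+ r * tot.
have E0 : 0 < E by rewrite mulr_gt0 ?exprn_gt0.
have A_down v x : A (v |: x) -> A x.
  rewrite /A; apply: le_trans; rewrite !multilinear_eval_indicator.
  apply: ler_sum => S _; apply: ler_wpM2l => //; rewrite /contains ler_nat.
  have [Sx|//] := boolP (S \subset x).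
  by rewrite (fintype.subset_trans Sx) ?subsetUr.
have A0 : A set0 by rewrite /A multilinear_eval_set0// mulr_ge0// ltW.
pose m := conditioned p A.
have m_ge0 := conditioned_ge0 p0 p1 A0.
have m_sum := conditioned_sum p0 p1 A0.
have m_dom := conditioned_dominated p0 p1 A_down A0.
have M0 : (0 < M)%N by apply: leq_trans aM; rewrite expn_gt0 a0.
have V0 : (0 < #|V|)%N.
  rewrite lt0n; apply: contraTneq tot0 => V0; rewrite -leNgt /tot big1// => S _.
  apply/eqP; rewrite -[_ == _]negbK; apply/negP => /c_unif cS.
  by have := max_card (mem S); rewrite V0 cS leqNgt r0.
have V0R : 0 < #|V|%:R :> R by rewrite ltr0n.
pose kappa := K * tot / #|V|%:R.
have kappa0 : 0 < kappa by rewrite !mulr_gt0 ?invr_gt0.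
have deg' (T : {set V}) : T != set0 -> degree c T <= kappa * (p / M%:R) ^+ (#|T| - 1).
  by move=> /deg; rewrite /kappa -!mulrA [_ ^+ _ * _]mulrC !mulrA.
have [W hW] := exists_pinning c_ge0 c_unif m_ge0 m_sum p0 m_dom M0 kappa0 deg' a0 r0 aM.
pose touch := p ^+ r * (\sum_(S : {set V} | ~~ (S \subset ~: W)) c S).
pose err x := decoupling_error c m W x + touch.
have touch0 : 0 <= touch by rewrite mulr_ge0 ?exprn_ge0 ?sumr_ge0// ltW.
have err0 x : 0 <= err x.
  by rewrite addr_ge0// sumr_ge0// => S _; rewrite mulr_ge0.
have err_mean : \sum_x m x * err x <= eps ^+ 2 * E.
  under eq_bigr do rewrite mulrDr.
  rewrite big_split/= -mulr_suml m_sum mul1r; apply: le_trans hW _.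
  rewrite /E [leRHS]mulrCA; apply: ler_wpM2l; first by rewrite exprn_ge0// ltW.
  have h1 : #|V|%:R * kappa * (8 ^+ r + 1) / (2 * a%:R) <= eps ^+ 2 / 2 * tot.
    have -> : #|V|%:R * kappa * (8 ^+ r + 1) / (2 * a%:R) =
        K * (8 ^+ r + 1) / a%:R / 2 * tot.
      by rewrite /kappa; field; rewrite pnatr_eq0 -lt0n a0 gt_eqF.
    apply: ler_wpM2r; first exact: ltW.
    by rewrite ler_pM2r// ler_pdivrMr ?ltr0n.
  have h2 : tot * (r * a ^ 2)%:R / M%:R <= eps ^+ 2 / 2 * tot.
    rewrite -mulrA mulrC; apply: ler_wpM2r; first exact: ltW.
    by rewrite ler_pdivrMr ?ltr0n// mulrAC ler_pdivlMr// mulrC.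
  by apply: le_trans (lerD h1 h2) _; rewrite -mulrDl -splitr.
pose qbar x v := if v \in W then p else marginal m v W x.
have q01 x v : 0 <= qbar x v <= 1.
  rewrite /qbar; case: ifPn => vW; first by rewrite !ltW.
  by rewrite marginal_ge0//= (le_trans (marginal_le m_ge0 (ltW p0) m_dom x vW))// ltW.
have qp x v : qbar x v <= p.
  by rewrite /qbar; case: ifPn => // vW; exact: (marginal_le m_ge0 (ltW p0) m_dom x vW).
have mean_q x : m x != 0 -> multilinear_eval (qbar x) <= eta * E + err x.
  move=> mx; rewrite /multilinear_eval (bigID (fun S : {set V} => S \subset ~: W))/=.
  rewrite /err addrA; apply: lerD; last first.
    rewrite /touch mulr_sumr; apply: ler_sum => S _; rewrite mulrC.
    have [->|cS] := eqVneq (c S) 0; first by rewrite !mulr0.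
    apply: ler_wpM2r => //; rewrite -(c_unif cS) -prodr_const.
    by apply: ler_prod => v _; rewrite qp; have /andP[-> _] := q01 x v.
  apply: (@le_trans _ _ (\sum_(S : {set V} | S \subset ~: W)
      c S * cond m W (contains R S) x + decoupling_error c m W x)).
    rewrite -big_split/=; apply: ler_sum => S SW; rewrite -mulrDr; apply: ler_wpM2l => //.
    have -> : \prod_(v in S) qbar x v = \prod_(v in S) marginal m v W x.
      apply: eq_bigr => v /(fintype.subsetP SW); rewrite inE => /negPf vW.
      by rewrite /qbar vW.
    by rewrite -lerBlDl distrC ler_norm.
  apply: lerD => //.
  apply: (@le_trans _ _ (\sum_S c S * cond m W (contains R S) x)).
    rewrite [leRHS](bigID (fun S : {set V} => S \subset ~: W))/= lerDl.
    by apply: sumr_ge0 => S _; rewrite mulr_ge0// cond_ge0// => y; exact: contains_ge0.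
  rewrite -(cond_sum m predT); apply: (cond_le m_ge0 _ mx) => y my.
  have : A y by apply: contraNT my => /negPf Ay; rewrite /m /conditioned Ay !mul0r.
  by rewrite /A multilinear_eval_indicator.
have KLq x : \sum_v bernoulli_KL p (qbar x v) =
    \sum_(v | v \notin W) bernoulli_KL p (marginal m v W x).
  rewrite (bigID (fun v => v \in W))/= big1 ?add0r => [|v vW].
    by apply: eq_bigr => v /negPf vW; rewrite /qbar vW.
  by rewrite /qbar vW bernoulli_KL_refl// p0.
apply: le_trans (entropy_budget p0 p1 A_down A0 W).
(* Markov's inequality, pointwise: the factor of [Phi] is at most one, and it is
   negative as soon as the error exceeds [eps * E]. *)
apply: (@le_trans _ _ (\sum_x m x * (Phi * (1 - err x / (eps * E))))); last first.
  apply: ler_sum => x _; rewrite -/(m x); have [->|mx] := eqVneq (m x) 0; first by rewrite !mul0r.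
  apply: ler_wpM2l => //; rewrite -KLq.
  have KL0 : 0 <= \sum_v bernoulli_KL p (qbar x v).
    by apply: sumr_ge0 => v _; rewrite bernoulli_KL_ge0// p0.
  have epsE : 0 < eps * E by rewrite mulr_gt0.
  have [small|large] := leP (err x) (eps * E).
    apply: (@le_trans _ _ Phi).
      rewrite -[leRHS]mulr1; apply: ler_wpM2l => //.
      by rewrite gerBl divr_ge0// ltW.
    apply: hPhi => //; rewrite mulrDl; apply: le_trans (mean_q x mx) _.
    by rewrite lerD2l.
  apply: le_trans KL0; apply: mulr_ge0_le0 => //.
  by rewrite subr_le0 ler_pdivlMr// mul1r ltW.
have -> : \sum_x m x * (Phi * (1 - err x / (eps * E))) =
    Phi * (1 - (\sum_x m x * err x) / (eps * E)).
  transitivity (Phi * (\sum_x m x - (\sum_x m x * err x) / (eps * E))); last by rewrite m_sum.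
  rewrite mulr_suml -sumrB mulr_sumr; apply: eq_bigr => x _.
  have e (k b d : R) : k * (Phi * (1 - b / d)) = Phi * (k - k * b / d) by ring.
  exact: e.
rewrite mulrC; apply: ler_wpM2l => //; rewrite lerD2l lerN2 ler_pdivrMr ?mulr_gt0// ?exprn_gt0//.
by rewrite mulrA -expr2.
Qed.

End LowerTail.

Local Open Scope classical_set_scope.

(** * Coefficients of multilinear polynomials *)

Section Polynomials.
Import -(notations) mpoly.
Import boot.finset.
Variables (R : realType) (V : finType).
Implicit Types (f : vpoly R V) (S B : {set V}) (v : V).

Definition set_monomial S : multinom #|V| :=
  Multinom [tuple (enum_val i \in S : nat) | i < #|V|].

Definition set_coeff f S : R := mcoeff (set_monomial S) f.

Lemma set_monomialE S i : set_monomial S i = (enum_val i \in S).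
Proof. exact: mnmE. Qed.

Lemma set_monomial_inj : injective set_monomial.
Proof.
move=> S S' e; apply/setP => v.
have := congr1 (fun m : multinom #|V| => m (enum_rank v)) e.
rewrite !set_monomialE enum_rankK.
by case: (v \in S); case: (v \in S').
Qed.

Lemma sum_over_coords (T : Type) (idx : T) (op : Monoid.com_law idx) (F : 'I_#|V| -> T) :
  \big[op/idx]_i F i = \big[op/idx]_v F (enum_rank v).
Proof.
rewrite (reindex (@enum_rank V))//=.
by apply: onW_bij; exact: enum_rank_bij.
Qed.

Lemma vpoly_evalE f (y : V -> R) : multilinear f ->
  vpoly_eval f y = multilinear_eval (set_coeff f) y.
Proof.
move=> mf; rewrite /vpoly_eval mevalE /multilinear_eval.
pose F (m : multinom #|V|) := mcoeff m f * \prod_i y (enum_val i) ^+ m i.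
transitivity (\sum_(m <- [seq set_monomial X | X <- enum {set V} & set_monomial X \in msupp f]) F m).
  apply: perm_big; apply: uniq_perm; first exact: msupp_uniq.
    rewrite map_inj_uniq; last exact: set_monomial_inj.
    by rewrite filter_uniq// enum_uniq.
  move=> m; apply/idP/mapP => [mm|[X + ->]]; last by rewrite mem_filter => /andP[].
  have e : m = set_monomial [set v | m (enum_rank v) == 1%N].
    apply/mnmP => i; rewrite set_monomialE inE enum_valK.
    by have := mf m mm i; case: (m i) => [|[|]].
  exists [set v | m (enum_rank v) == 1%N] => //.
  by rewrite mem_filter -e mm mem_enum.
rewrite big_map big_filter big_enum_cond/= big_mkcond/=; apply: eq_bigr => S _.
rewrite /F /set_coeff sum_over_coords [in RHS]big_mkcond/=.
case: ifPn => Sf.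
  congr (_ * _); apply: eq_bigr => v _; rewrite set_monomialE enum_rankK.
  by case: (v \in S); rewrite ?expr1 ?expr0.
by rewrite memN_msupp_eq0// mul0r.
Qed.

Lemma set_coeff_card r f S : homogeneous r f -> set_coeff f S != 0 -> #|S| = r.
Proof.
move=> hf; rewrite /set_coeff -mcoeff_msupp => /(dhomog_mf hf) <-.
rewrite /= mdegE sum_over_coords -sum1_card big_mkcond/=; apply: eq_bigr => v _.
by rewrite set_monomialE enum_rankK; case: (v \in S).
Qed.

Lemma multilinear_mderiv f v : multilinear f -> multilinear (mderiv (enum_rank v) f).
Proof.
move=> mf m; rewrite mcoeff_msupp mcoeff_deriv => h i.
have : mnm_add m (mnm1 (enum_rank v)) \in msupp f.
  by rewrite mcoeff_msupp; apply: contraNneq h => ->; rewrite mul0rn.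
by move=> /mf/(_ i); rewrite mnmDE; apply: leq_trans; rewrite leq_addr.
Qed.

Lemma set_coeff_mderiv f v S : multilinear f ->
  set_coeff (mderiv (enum_rank v) f) S = if v \in S then 0 else set_coeff f (v |: S).
Proof.
move=> mf; rewrite /set_coeff mcoeff_deriv; case: ifPn => vS.
  rewrite memN_msupp_eq0 ?mul0rn//; apply/negP => /mf/(_ (enum_rank v)).
  by rewrite mnmDE set_monomialE enum_rankK vS mnm1E eqxx.
have -> : mnm_add (set_monomial S) (mnm1 (enum_rank v)) = set_monomial (v |: S).
  apply/mnmP => i; rewrite mnmDE !set_monomialE mnm1E !inE.
  have -> : (enum_rank v == i) = (enum_val i == v).
    by apply/eqP/eqP => [<-|<-]; rewrite ?enum_rankK ?enum_valK.
  by case: eqP => [->|_]; rewrite ?(negPf vS) ?addn0.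
by rewrite set_monomialE enum_rankK (negPf vS) mulr1n.
Qed.

(** A derivative lowers by one the sets that contain [v] and kills the others;
    iterating over [B] turns partial derivatives into degrees. *)
Lemma degree_mderiv f v B : multilinear f -> v \notin B ->
  degree (set_coeff (mderiv (enum_rank v) f)) B = degree (set_coeff f) (v |: B).
Proof.
move=> mf vB; rewrite /degree.
under eq_bigr do rewrite set_coeff_mderiv//.
rewrite (bigID (fun S : {set V} => v \in S))/= big1 ?add0r; last by move=> S /andP[_ ->].
rewrite [RHS](reindex_onto (fun S => v |: S) (fun S => S :\ v))/=; last first.
  by move=> S vBS; rewrite setD1K// (fintype.subsetP vBS)// setU11.
apply: eq_big => [S|S /andP[_ /negPf ->]//].
have [vS|vS] /= := boolP (v \in S).
  rewrite andbF; apply/esym/negbTE; rewrite negb_and; apply/orP; right.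
  by apply/eqP => e; move: vS; rewrite -e setD11.
rewrite andbT setU1K// eqxx andbT; apply/idP/idP => h; first exact: setUS.
apply/fintype.subsetP => u uB; have := fintype.subsetP h u.
rewrite !inE uB orbT => /(_ isT) /orP[/eqP uv|//].
by rewrite uv (negPf vB) in uB.
Qed.

Lemma partial_degree f B : multilinear f ->
  vpoly_eval (partial B f) (fun=> 1) = degree (set_coeff f) B.
Proof.
move=> mf; rewrite /partial.
pose D s := foldr (fun v g => mderiv (enum_rank v) g) f s : vpoly R V.
have mD s : multilinear (D s) by elim: s => //= v s; exact: multilinear_mderiv.
have deg (s : seq V) B' : uniq s -> {in s, forall v, v \notin B'} ->
    degree (set_coeff (D s)) B' = degree (set_coeff f) (B' :|: [set v in s]).
  elim: s B' => [|v s IH] B'; first by rewrite set_nil setU0.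
  move=> /= /andP[vs us] vsB'.
  have vB' : v \notin B' by apply: vsB'; rewrite mem_head.
  rewrite degree_mderiv// IH//; last first.
    move=> u us'; rewrite !inE negb_or vsB' ?inE ?us' ?orbT// andbT.
    by apply: contraNneq vs => <-.
  by rewrite set_cons setUA [B' :|: [set v]]setUC.
have -> : vpoly_eval (D (enum B)) (fun=> 1) = degree (set_coeff (D (enum B))) set0.
  rewrite vpoly_evalE// /multilinear_eval /degree; apply: eq_big => [S|S _].
    by rewrite sub0set.
  by rewrite big1// mulr1.
rewrite deg ?enum_uniq//; last by move=> v _; rewrite inE.
by congr degree; apply/setP => v; rewrite !inE mem_enum.
Qed.

Lemma vpoly_eval1 f : multilinear f -> vpoly_eval f (fun=> 1) = \sum_S set_coeff f S.
Proof. by move=> mf; rewrite vpoly_evalE//; apply: eq_bigr => S _; rewrite big1// mulr1. Qed.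

Lemma mean_bernoulliE f (q : V -> R) : multilinear f ->
  mean_bernoulli q f = multilinear_eval (set_coeff f) q.
Proof.
move=> mf; rewrite /mean_bernoulli.
under eq_bigr do rewrite vpoly_evalE// /multilinear_eval mulr_sumr.
rewrite exchange_big/=; apply: eq_bigr => S _.
under eq_bigr do rewrite mulrCA; rewrite -mulr_sumr; congr (_ * _).
transitivity (\sum_(w : {ffun V -> bool}) \prod_v
    (bernoulli_pmf (q v) (w v) * (if v \in S then (w v)%:R else 1))).
  by apply: eq_bigr => w _; rewrite big_split/= -big_mkcond.
rewrite -(bigA_distr_bigA (fun v b => bernoulli_pmf (q v) b * (if v \in S then b%:R else 1)))/=.
rewrite [RHS]big_mkcond/=; apply: eq_bigr => v _; rewrite big_bool/=.
by case: ifP => _; rewrite ?mulr1 ?mulr0 ?addr0// addrC subrK.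
Qed.

Lemma multilinear_eval_const r f (p : R) : homogeneous r f ->
  multilinear_eval (set_coeff f) (fun=> p) = p ^+ r * \sum_S set_coeff f S.
Proof.
move=> hf; rewrite mulr_sumr; apply: eq_bigr => S _; rewrite prodr_const mulrC.
by have [->|/(set_coeff_card hf) ->//] := eqVneq (set_coeff f S) 0; rewrite !mulr0.
Qed.

End Polynomials.

(** * The law of the support *)

Section ProductLaw.
Variables (R : realType) (V : finType) (d : measure_display) (T : measurableType d).
Variables (P : probability T R) (p : R) (Y : V -> {RV P >-> bool}).
Hypotheses (p01 : 0 <= p <= 1) (hY : iid_bernoulli p Y).

Definition support_of (t : T) : {set V} := finset (fun v => Y v t).

Lemma support_preimage x : support_of @^-1` [set x] =
  \bigcap_(v in [set` (finset.setT : {set V})]) (Y v @^-1` [set v \in x]).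
Proof.
apply/seteqP; split => t /=; first by move=> <- v _; rewrite /= inE.
by move=> h; apply/setP => v; rewrite inE; apply: h; rewrite /= inE.
Qed.

Lemma support_measurable x : measurable (support_of @^-1` [set x]).
Proof.
rewrite support_preimage; apply: fin_bigcap_measurable; first exact: finite_finset.
by move=> v _; exact: measurable_funPTI.
Qed.

Lemma support_prob x : P (support_of @^-1` [set x]) = (product_weight p x)%:E.
Proof.
rewrite support_preimage.
have [hd hi] := hY; rewrite hi /product_weight -prodEFin.
apply: eq_big => [v|v _]; first by rewrite inE.
have := hd v [set v \in x]; rewrite /distribution /pushforward => ->.
have mem1 (a b : bool) : (a \in [set b]) = (a == b).
  by apply/idP/eqP => [|->]; rewrite inE.
rewrite bernoulli_probE// !diracE !mem1; case: (v \in x) => /=.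
  by rewrite mule1 mule0 adde0.
by rewrite mule0 mule1 add0e.
Qed.

Lemma support_expectation (g : {set V} -> R) : (forall x, 0 <= g x) ->
  ('E_P[fun t => g (support_of t)] = (\sum_x product_weight p x * g x)%R%:E)%E.
Proof.
move=> g0; rewrite expectation.unlock.
pose F (x : {set V}) (t : T) := (g x * \1_(support_of @^-1` [set x]) t)%:E.
have mI x : measurable_fun setT (fun t => \1_(support_of @^-1` [set x]) t : R).
  by apply: measurable_realfun.measurable_indic; exact: support_measurable.
transitivity (\int[P]_t (\sum_(x : {set V}) F x t))%E.
  apply: eq_integral => t _; rewrite (bigD1 (support_of t))//= big1 => [|x xt].
    by rewrite adde0 /F indicE mem_set// mulr1.
  rewrite /F indicE memNset ?mulr0//= => e.
  by rewrite e eqxx in xt.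
rewrite ge0_integral_sum//; last first.
- by move=> x t _; rewrite lee_fin mulr_ge0.
- by move=> x; apply/measurable_realfun.measurable_EFinP; exact: measurable_realfun.measurable_funM.
rewrite -sumEFin; apply: eq_bigr => x _.
rewrite /F (integralZl_indic measurableT (fun=> support_of @^-1` [set x]))//; last first.
- exact: support_measurable.
- by move=> /lt_geF; rewrite g0.
rewrite integral_indic//; last exact: support_measurable.
rewrite setIT mulrC EFinM; congr (_ * _)%E; exact: support_prob.
Qed.

Lemma support_event_measurable (A : pred {set V}) : measurable [set t | A (support_of t)].
Proof.
have -> : [set t | A (support_of t)] =
    \bigcup_(x in [set x | A x]) (support_of @^-1` [set x]).
  apply/seteqP; split => t /=; first by move=> At; exists (support_of t).
  by move=> [x /= Ax ->].
apply: fin_bigcup_measurable; first exact: finite_finset.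
by move=> x _; exact: support_measurable.
Qed.

Lemma support_event (A : pred {set V}) :
  P [set t | A (support_of t)] = (event_weight p A)%:E.
Proof.
have mA := support_event_measurable A.
rewrite -expectation_indic//.
have -> : \1_[set t | A (support_of t)] = (fun t => (A (support_of t))%:R) :> (T -> R).
  apply/funext => t; rewrite indicE; congr (nat_of_bool _ : nat)%:R.
  by apply/idP/idP; rewrite inE.
rewrite (support_expectation (g := fun x => (A x)%:R))// /event_weight.
congr (_%:E); rewrite [RHS]big_mkcond/=; apply: eq_bigr => x _.
by case: (A x); rewrite ?mulr1 ?mulr0.
Qed.

End ProductLaw.

(** * The rate function *)

Section RateFunctionBounds.
Variables (R : realType) (V : finType) (f : vpoly R V) (p eta : R).
Hypotheses (p_gt0 : 0 < p) (p_lt1 : p < 1) (ne : feasible p f eta !=set0).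

Lemma Phi_ge0 : 0 <= Phi p f eta.
Proof.
have [q [[q01 _] _ ->]] := Phi_min p_gt0 p_lt1 ne.
apply: sumr_ge0 => v _; apply: bernoulli_KL_ge0; last exact: q01.
by rewrite p_gt0.
Qed.

Lemma Phi_le q : feasible p f eta q -> Phi p f eta <= KL_divergence p q.
Proof. by have [q' [_ qmin ->]] := Phi_min p_gt0 p_lt1 ne; exact: qmin. Qed.

End RateFunctionBounds.

Theorem theorem6 (R : realType) (r : nat) (p0 eps K : R) :
  (0 < r)%N -> p0 < 1 -> 0 < eps ->
  exists lambda C : R, 0 < lambda /\
  forall (V : finType) (f : vpoly R V) (p : R)
    (d : measure_display) (T : measurableType d) (P : probability T R)
    (Y : V -> {RV P >-> bool}),
  homogeneous r f -> multilinear f -> nonneg_coeffs f ->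
  0 < p -> p <= p0 ->
  iid_bernoulli p Y ->
  (forall B : {set V}, B != finset.set0 -> (#|B| <= r)%N ->
     vpoly_eval (partial B f) (fun=> 1) <=
       K * (lambda * p) ^+ (#|B| - 1) *
       (vpoly_eval f (fun=> 1) / #|V|%:R)) ->
  let X := fun t : T => vpoly_eval f (fun v => (Y v t)%:R) in
  forall eta : R, 0 <= eta ->
  (- lne (P [set t | ((X t)%:E <= eta%:E * 'E_P[X])%E]) >=
     ((1 - eps) * Phi p f (eta + eps) - C)%:E)%E.
Proof.
move=> r0 p01 eps0.
pose K' := Num.max K 1.
have K'0 : 0 < K' by rewrite lt_max ltr01 orbT.
have eps20 : 0 < eps ^+ 2 by rewrite exprn_gt0.
have bound_gt (x : R) : 0 <= x -> x <= (Num.bound x)%:R.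
  by move=> x0; rewrite ltW// archi_boundP.
(* Half of the error budget [eps ^ 2] goes to the decoupling error, which fixes
   [a], and half to the monomials meeting the pinned set, which fixes [M]. *)
pose a := (Num.bound (K' * (8 ^+ r + 1) / eps ^+ 2)).+1.
have ha : K' * (8 ^+ r + 1) <= eps ^+ 2 * a%:R.
  rewrite -ler_pdivrMl// mulrC; apply: le_trans (bound_gt _ _) _; last by rewrite ler_nat.
  by rewrite mulr_ge0 ?invr_ge0 ?(ltW eps20)// mulr_ge0 ?(ltW K'0)// addr_ge0// exprn_ge0.
pose M := maxn (a ^ 2) (Num.bound (2 * (r * a ^ 2)%:R / eps ^+ 2)).
have hM : 2 * (r * a ^ 2)%:R <= eps ^+ 2 * M%:R.
  rewrite -ler_pdivrMl// mulrC; apply: le_trans (bound_gt _ _) _.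
    by rewrite mulr_ge0 ?invr_ge0 ?(ltW eps20)// mulr_ge0.
  by rewrite ler_nat leq_maxr.
have aM : (a ^ 2 <= M)%N by exact: leq_maxl.
have M0 : (0 < M)%N by apply: leq_trans aM; rewrite expn_gt0.
exists M%:R^-1, 0; split; first by rewrite invr_gt0 ltr0n.
move=> V f p d T P Y hf mf nf p_gt0 pp0 hY hdeg X eta eta0.
have p_lt1 : p < 1 := le_lt_trans pp0 p01.
have p01' : 0 <= p <= 1 by rewrite !ltW.
rewrite subr0; set c := set_coeff f.
have c_ge0 S : 0 <= c S by exact: nf.
have c_unif S : c S != 0 -> #|S| = r by exact: (set_coeff_card hf).
pose tot := \sum_S c S.
have XE t : X t = multilinear_eval c (fun v => (v \in support_of Y t)%:R).
  by rewrite /X vpoly_evalE//; apply: eq_bigr => S _; congr (_ * _);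
     apply: eq_bigr => v _; rewrite inE.
have EX : ('E_P[X] = (p ^+ r * tot)%:E)%E.
  pose g (x : {set V}) := multilinear_eval c (fun v => (v \in x)%:R).
  have g0 x : 0 <= g x.
    by apply: sumr_ge0 => S _; rewrite mulr_ge0// prodr_ge0.
  have -> : X = (fun t => g (support_of Y t)) by apply/funext => t; rewrite XE.
  rewrite (support_expectation p01' hY g0); congr (_%:E).
  rewrite -(multilinear_eval_const p hf) /g.
  under eq_bigr do rewrite multilinear_eval_indicator mulr_sumr.
  rewrite exchange_big/=; apply: eq_bigr => S _.
  under eq_bigr do rewrite mulrCA.
  by rewrite -mulr_sumr product_weight_contains prodr_const.
pose A (x : {set V}) := multilinear_eval c (fun v => (v \in x)%:R) <= eta * (p ^+ r * tot).
have -> : [set t | ((X t)%:E <= eta%:E * 'E_P[X])%E] = [set t | A (support_of Y t)].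
  by apply/funext => t /=; rewrite EX -EFinM lee_fin XE.
have etaeps : 0 <= eta + eps by rewrite addr_ge0// ltW.
have ne := feasible_nonempty r0 hf nf p_gt0 p_lt1 etaeps.
have Phi0 := Phi_ge0 p_gt0 p_lt1 ne.
have mean_p : mean_bernoulli (fun=> p) f = p ^+ r * tot.
  by rewrite mean_bernoulliE// (multilinear_eval_const _ hf).
have tot_ge0 : 0 <= tot by exact: sumr_ge0.
have [tot0|tot0] := eqVneq tot 0.
  have Phi_eq0 : Phi p f (eta + eps) = 0.
    apply/eqP; rewrite eq_le Phi0 andbT; apply: le_trans (Phi_le p_gt0 p_lt1 ne (q := fun=> p) _) _.
      by split; [move=> v|rewrite mean_p tot0 !mulr0].
    rewrite /KL_divergence big1// => v _; apply: bernoulli_KL_refl.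
    by rewrite p_gt0.
  rewrite Phi_eq0 mulr0 oppe_ge0 lne_le0; apply: probability_le1.
  exact: support_event_measurable.
have tot_gt0 : 0 < tot by rewrite lt_neqAle eq_sym tot0.
have deg (B : {set V}) : B != finset.set0 ->
    degree c B <= K' * (p / M%:R) ^+ (#|B| - 1) * (tot / #|V|%:R).
  move=> B0; have rhs0 : 0 <= (p / M%:R) ^+ (#|B| - 1) * (tot / #|V|%:R).
    by rewrite mulr_ge0 ?exprn_ge0 ?divr_ge0// ltW.
  have [Br|Br] := leqP #|B| r; last first.
    have [->|/(degree_card c_unif)] := eqVneq (degree c B) 0.
      by rewrite -mulrA mulr_ge0// ltW.
    by rewrite leqNgt Br.
  rewrite -partial_degree//; apply: le_trans (hdeg B B0 Br) _.
  rewrite vpoly_eval1// [_^-1 * p]mulrC -!mulrA; apply: ler_wpM2r => //.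
  by rewrite le_max lexx.
have hPhi q : (forall v, 0 <= q v <= 1) ->
    multilinear_eval c q <= (eta + eps) * (p ^+ r * tot) ->
    Phi p f (eta + eps) <= \sum_v bernoulli_KL p (q v).
  move=> q01 hq; apply: (Phi_le p_gt0 p_lt1 ne (q := q)); split=> //.
  by rewrite mean_bernoulliE// mean_p.
rewrite (support_event p01' hY A).
have A0 : A finset.set0.
  by rewrite /A (multilinear_eval_set0 c_unif r0) mulr_ge0// mulr_ge0// exprn_ge0// ltW.
rewrite lne_EFin ?event_weight_gt0// -EFinN lee_fin.
apply: (lower_tail_entropy c_ge0 c_unif (a := a) (M := M) (K := K')) => //.
by rewrite p_gt0.
Qed.
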